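(* Let $n\ge4$ and let $(\mathcal{M}^n,g)=(\mathbb{R}^n,\delta+df\otimes df)$ be the graph of a smooth asymptotically flat function $f:\mathbb{R}^n\to\mathbb{R}$ of decay order $\tau>\frac{n-2}{2}$. Let $\alpha$ be a real constant and suppose that $R+\alpha L_2$ is integrable on $(\mathcal{M}^n,g)$, where $R$ is the scalar curvature and $L_2$ the second Gauss-Bonnet curvature of $g$. Then $$m_{ADM}=m_{EGB}=\frac{1}{2(n-1)\omega_{n-1}}\int_{\mathcal{M}^n}\big(R+\alpha L_2\big)\frac{1}{\sqrt{1+|\nabla_\delta f|^2}}\,dV_g.$$ In particular, $R+\alpha L_2\ge0$ yields $m_{ADM}\ge0$.
   Context: $\delta$ is the Euclidean metric and $\nabla_\delta f$ the Euclidean gradient, with Euclidean norm. A smooth function $f$ with first, second and third partial derivatives $f_i,f_{ij},f_{ijk}$ is asymptotically flat of order $\tau$ if $f_i(x)=O(|x|^{-\tau/2})$ and $|x||f_{ij}(x)|+|x|^2|f_{ijk}(x)|=O(|x|^{-\tau/2})$ at infinity. Curvature conventions (summation convention used): $R_{ijk}^{m}=\partial_i\Gamma^m_{jk}-\partial_j\Gamma^m_{ik}+\Gamma^m_{is}\Gamma^s_{jk}-\Gamma^m_{js}\Gamma^s_{ik}$, $R_{ijkl}=g_{km}R^m_{ijl}$, $R_{ik}=g^{jl}R_{ijkl}$, $R=g^{ik}R_{ik}$; indices are raised with $g$. $L_2=R_{ijkl}R^{ijkl}-4R_{ij}R^{ij}+R^2$, and $$P^{ijkl}=R^{ijkl}+R^{jk}g^{il}-R^{jl}g^{ik}-R^{ik}g^{jl}+R^{il}g^{jk}+\tfrac12R(g^{ik}g^{jl}-g^{il}g^{jk}).$$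 The ADM mass and the Einstein-Gauss-Bonnet mass (with parameter $\alpha$) are, in the standard coordinates of $\mathbb{R}^n$, $$m_{ADM}=\frac{1}{2(n-1)\omega_{n-1}}\lim_{r\to\infty}\int_{S_r}(g_{ij,i}-g_{ii,j})\nu_j\,dS,$$ $$m_{EGB}=\frac{1}{2(n-1)\omega_{n-1}}\lim_{r\to\infty}\int_{S_r}\{(g_{ij,j}-g_{jj,i})+2\alpha P^{ijkl}g_{jk,l}\}\nu_i\,dS,$$ where $g_{ij,k}=\partial_kg_{ij}$, $S_r$ is the Euclidean coordinate sphere of radius $r$, $\nu$ its Euclidean outward unit normal, $dS$ its Euclidean area element, and $\omega_{n-1}$ the volume of the unit sphere $\mathbb{S}^{n-1}$. *)

(* Defs.v *)
From HB Require Import structures.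
From mathcomp Require Import all_boot all_order all_algebra.
From mathcomp Require Import all_classical all_reals all_analysis.
From mathcomp Require Import measurable_realfun.

Set Implicit Arguments.
Unset Strict Implicit.
Unset Printing Implicit Defensive.
Import Order.TTheory GRing.Theory Num.Theory.
Import numFieldNormedType.Exports.
Local Open Scope classical_set_scope.
Local Open Scope ring_scope.

(* R^n is 'rV[R]_n. The norm `|x| of the library on 'rV[R]_n is the sup norm
   (same topology and derivatives); the Euclidean norm is enorm. *)

Section lebesgue_Rn.
Context {R : realType}.

(* The measurable sets are generated by the coordinates: the Borel sets. *)
Section measurable_rV.
Variable n : nat.
Let coors : 'I_n -> 'rV[R]_n -> R := fun i x => x 0 i.

Let rV_set0 : g_sigma_preimage coors set0.
Proof. exact: sigma_algebra0. Qed.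

Let rV_setC A : g_sigma_preimage coors A -> g_sigma_preimage coors (~` A).
Proof. exact: sigma_algebraC. Qed.

Let rV_bigcup (F : _^nat) : (forall i, g_sigma_preimage coors (F i)) ->
  g_sigma_preimage coors (\bigcup_i (F i)).
Proof. exact: sigma_algebra_bigcup. Qed.

HB.instance Definition _ :=
  @isMeasurable.Build (measure_tuple_display default_measure_display)
    'rV[R]_n (g_sigma_preimage coors) rV_set0 rV_setC rV_bigcup.
End measurable_rV.

Lemma measurable_coord n (i : 'I_n) :
  measurable_fun [set: 'rV[R]_n] (fun x => x 0 i).
Proof.
move=> _ Y mY; rewrite setTI; apply: sub_sigma_algebra => /=.
rewrite -bigcup_seq/=; exists i => /=; first by rewrite mem_index_enum.
by exists Y => //; rewrite setTI.
Qed.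

Lemma measurable_fun_coordP d (T : measurableType d) n (f : T -> 'rV[R]_n) :
  (forall i, measurable_fun [set: T] (fun t => f t 0 i)) ->
  measurable_fun [set: T] f.
Proof.
move=> mf.
have mS : g_sigma_preimage (fun i => (fun x : 'rV[R]_n => x 0 i) \o f)
    `<=` measurable.
  apply: smallest_sub; first exact: sigma_algebra_measurable.
  case: n f mf => [|n] f mf; first by rewrite big_ord0.
  rewrite -bigcup_mkord_ord; apply: bigcup_sub => i Ii.
  by move=> A [B mB <-]; exact: mf.
move=> _ A mA; apply: mS; rewrite g_sigma_preimage_comp.
by exists A.
Qed.

Definition consr n (p : R * 'rV[R]_n) : 'rV[R]_n.+1 :=
  \row_i oapp (p.2 0) p.1 (unlift ord0 i).

Definition unconsr n (x : 'rV[R]_n.+1) : R * 'rV[R]_n :=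
  (x 0 0, \row_j x 0 (lift ord0 j)).

Lemma consr0 n (p : R * 'rV[R]_n) : consr p 0 0 = p.1.
Proof. by rewrite mxE unlift_none. Qed.

Lemma consr_lift n (p : R * 'rV[R]_n) j : consr p 0 (lift ord0 j) = p.2 0 j.
Proof. by rewrite mxE liftK. Qed.

Lemma consrK n : cancel (@consr n) (@unconsr n).
Proof.
move=> [a y]; rewrite /unconsr consr0; congr pair.
by apply/rowP => j; rewrite mxE consr_lift.
Qed.

Lemma unconsrK n : cancel (@unconsr n) (@consr n).
Proof.
move=> x; apply/rowP => i.
have [j ->|->] := unliftP ord0 i; first by rewrite consr_lift mxE.
by rewrite consr0.
Qed.

Lemma measurable_consr n : measurable_fun setT (@consr n).
Proof.
apply: measurable_fun_coordP => i.
have [j ->|->] := unliftP ord0 i.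
  under eq_fun do rewrite consr_lift.
  exact: (measurableT_comp (measurable_coord j) measurable_snd).
by under eq_fun do rewrite consr0; exact: measurable_fst.
Qed.

Lemma measurable_unconsr n : measurable_fun setT (@unconsr n).
Proof.
apply: measurable_fun_pair; first exact: measurable_coord.
apply: measurable_fun_coordP => j.
by under eq_fun do rewrite mxE; exact: measurable_coord.
Qed.

Section lebesgue_consr.
Variables (n : nat) (m : {sigma_finite_measure set 'rV[R]_n -> \bar R}).

Definition lebesgue_consr : set 'rV[R]_n.+1 -> \bar R :=
  pushforward (@lebesgue_measure R \x m)%E (@consr n).

Let mconsr := @measurable_consr n.

Let lebesgue_consr0 : lebesgue_consr set0 = 0%E.
Proof. exact: measure0. Qed.

Let lebesgue_consr_ge0 A : (0 <= lebesgue_consr A)%E.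
Proof. exact: measure_ge0. Qed.

Let lebesgue_consr_sigma_additive : semi_sigma_additive lebesgue_consr.
Proof. exact: measure_semi_sigma_additive. Qed.

HB.instance Definition _ := isMeasure.Build _ _ _ lebesgue_consr
  lebesgue_consr0 lebesgue_consr_ge0 lebesgue_consr_sigma_additive.

Let lebesgue_consr_sigma_finite : sigma_finite setT lebesgue_consr.
Proof.
have /sigma_finiteP[F [TF ndF Foo]] :=
  @sigma_finiteT _ _ _ (@lebesgue_measure R).
have /sigma_finiteP[G [TG ndG Goo]] := @sigma_finiteT _ _ _ m.
exists (fun k => @unconsr n @^-1` (F k `*` G k)).
  rewrite -preimage_bigcup -(preimage_setT (@unconsr n)); congr (_ @^-1` _).
  rewrite -setXTT TF TG predeqE => -[x y]; split.
    move=> [/= [i _ Fix] [k _ Gky]]; exists (maxn i k) => //; split.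
    - by move: x Fix; exact/subsetPset/ndF/leq_maxl.
    - by move: y Gky; exact/subsetPset/ndG/leq_maxr.
  by move=> [i _ []/= ? ?]; split; exists i.
move=> k; have [mF Fk] := Foo k; have [mG Gk] := Goo k; split.
  rewrite -[X in measurable X]setTI; apply: measurable_unconsr => //.
  exact: measurableX.
rewrite /lebesgue_consr /pushforward (_ : _ @^-1` _ = F k `*` G k).
  by rewrite product_measure1E// lte_mul_pinfty// ge0_fin_numE.
rewrite -comp_preimage (_ : _ \o _ = id) ?preimage_id//.
by apply/funext => p; exact: consrK.
Qed.

HB.instance Definition _ := Measure_isSigmaFinite.Build _ _ _ lebesgue_consr
  lebesgue_consr_sigma_finite.
End lebesgue_consr.

Fixpoint lebesgue_Rn n : {sigma_finite_measure set 'rV[R]_n -> \bar R} :=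
  if n is n'.+1 then lebesgue_consr (lebesgue_Rn n') else dirac (0 : 'rV[R]_0).

End lebesgue_Rn.

Section euclidean_sphere.
Context {R : realType}.

Definition enorm n (x : 'rV[R]_n) : R := Num.sqrt (\sum_i x 0 i ^+ 2).

Lemma measurable_enorm n : measurable_fun setT (@enorm n).
Proof.
rewrite (_ : @enorm n = (fun t => t `^ 2^-1) \o
                        (fun x : 'rV[R]_n => \sum_i x 0 i ^+ 2)).
  apply: measurableT_comp; first exact: measurable_powR.
  apply: measurable_sum => i.
  exact: measurable_funX (measurable_coord i).
apply/funext => x /=; rewrite powR12_sqrt//.
by apply: sumr_ge0 => i _; exact: sqr_ge0.
Qed.

Definition unit_ball n : set 'rV[R]_n := [set x | enorm x <= 1].

Lemma measurable_unit_ball n : measurable (@unit_ball n).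
Proof.
rewrite (_ : @unit_ball n = setT `&` @enorm n @^-1` `]-oo, 1]).
  by apply: measurable_enorm => //; exact: measurable_itv.
by rewrite setTI; apply/funext => x; rewrite /unit_ball /= in_itv.
Qed.

(* The Euclidean outward unit normal at x of the sphere of radius |x|. *)
Definition unit_normal n (x : 'rV[R]_n) : 'rV[R]_n := (enorm x)^-1 *: x.

Lemma measurable_unit_normal n : measurable_fun setT (@unit_normal n).
Proof.
apply: measurable_fun_coordP => i.
rewrite (_ : (fun _ => _) = (fun x : 'rV[R]_n => enorm x `^ (-1) * x 0 i)).
  apply: measurable_funM; last exact: measurable_coord.
  exact: (measurableT_comp (measurable_powR (-1)) (@measurable_enorm n)).
by apply/funext => x; rewrite mxE powR_inv1// sqrtr_ge0.
Qed.

Section cone_measure.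
Variable n : nat.

(* The volume of the cone {t theta | theta in A, 0 < t <= 1} over A. *)
Definition cone_measure : set 'rV[R]_n -> \bar R :=
  pushforward (mrestr (lebesgue_Rn n) (@measurable_unit_ball n))
    (@unit_normal n).

Let mnormal := @measurable_unit_normal n.

Let cone_measure0 : cone_measure set0 = 0%E.
Proof. exact: measure0. Qed.

Let cone_measure_ge0 A : (0 <= cone_measure A)%E.
Proof. exact: measure_ge0. Qed.

Let cone_measure_sigma_additive : semi_sigma_additive cone_measure.
Proof. exact: measure_semi_sigma_additive. Qed.

HB.instance Definition _ := isMeasure.Build _ _ _ cone_measure
  cone_measure0 cone_measure_ge0 cone_measure_sigma_additive.
End cone_measure.

(* The area measure of the unit sphere S^(n-1), carried by 'rV[R]_n: the area of
   A is n times the volume of the cone over A, as in polar coordinates. *)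
Definition sphere_measure n : {measure set 'rV[R]_n -> \bar R} :=
  mscale (n%:R)%:nng (@cone_measure n).

Definition sphere_area n : R := fine (sphere_measure n setT).

(* The integral of F over the sphere S_r for its area element: S_r is
   parametrized by the unit sphere, and dS scales by r^(n-1). *)
Definition sphere_integral n (r : R) (F : 'rV[R]_n -> R) : R :=
  r ^+ n.-1 * \int[sphere_measure n]_theta F (r *: theta).

End euclidean_sphere.

Section smooth_functions.
Context {R : realType} {n : nat}.
Implicit Types f : 'rV[R]_n -> R.

Definition partial (i : 'I_n) f : 'rV[R]_n -> R :=
  fun x => 'D_(delta_mx 0 i) f x.

Fixpoint Ck (k : nat) f : Prop :=
  continuous f /\
  if k is k'.+1 then
    forall i, (forall x, derivable f x (delta_mx 0 i)) /\ Ck k' (partial i f)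
  else True.

Definition smooth f : Prop := forall k, Ck k f.

(* u(x) = O(|x|^p) at infinity. *)
Definition bigO_infty (u : 'rV[R]_n -> R) (p : R) : Prop :=
  exists C M : R, forall x, M < enorm x -> `|u x| <= C * enorm x `^ p.

Definition asymptotically_flat (tau : R) f : Prop :=
  (forall i, bigO_infty (partial i f) (- tau / 2)) /\
  (forall i j k, bigO_infty
     (fun x => enorm x * `|partial j (partial i f) x| +
        enorm x ^+ 2 * `|partial k (partial j (partial i f)) x|)
     (- tau / 2)).

Definition grad f (x : 'rV[R]_n) : 'rV[R]_n := \row_i partial i f x.

End smooth_functions.

Section curvature.
Context {R : realType} {n : nat}.
Variable g : 'rV[R]_n -> 'M[R]_n.
Implicit Types (i j k l m : 'I_n) (x : 'rV[R]_n).

(* g_{ij,k} *)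
Definition dmetric i j k x : R := partial k (fun y => g y i j) x.

Definition invmetric x : 'M[R]_n := invmx (g x).

(* Gamma^m_{ij} *)
Definition christoffel m i j x : R :=
  2^-1 * \sum_k invmetric x m k *
    (dmetric j k i x + dmetric i k j x - dmetric i j k x).

(* R_{ijk}^m *)
Definition riemann_up i j k m x : R :=
  partial i (christoffel m j k) x - partial j (christoffel m i k) x +
  \sum_s (christoffel m i s x * christoffel s j k x -
          christoffel m j s x * christoffel s i k x).

(* R_{ijkl} *)
Definition riemann_curv i j k l x : R :=
  \sum_m g x k m * riemann_up i j l m x.

(* R_{ik} *)
Definition ricci_curv i k x : R :=
  \sum_j \sum_l invmetric x j l * riemann_curv i j k l x.

Definition scalar_curv x : R := \sum_i \sum_k invmetric x i k * ricci_curv i k x.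

(* R^{ijkl} *)
Definition riemann_raised i j k l x : R :=
  \sum_a \sum_b \sum_c \sum_d
    invmetric x i a * invmetric x j b * invmetric x k c * invmetric x l d *
    riemann_curv a b c d x.

(* R^{ij} *)
Definition ricci_raised i j x : R :=
  \sum_a \sum_b invmetric x i a * invmetric x j b * ricci_curv a b x.

(* L_2 *)
Definition gauss_bonnet x : R :=
  (\sum_i \sum_j \sum_k \sum_l riemann_curv i j k l x * riemann_raised i j k l x)
  - 4 * (\sum_i \sum_j ricci_curv i j x * ricci_raised i j x)
  + scalar_curv x ^+ 2.

(* P^{ijkl} *)
Definition P_tensor i j k l x : R :=
  let G := invmetric x in let Ric i j := ricci_raised i j x in
  riemann_raised i j k l x + Ric j k * G i l - Ric j l * G i k
  - Ric i k * G j l + Ric i l * G j k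
  + 2^-1 * scalar_curv x * (G i k * G j l - G i l * G j k).

Definition volume_density x : R := Num.sqrt (\det (g x)).

(* Integrability and integral for dV_g = sqrt(det g) dx. *)
Definition g_integrable (h : 'rV[R]_n -> R) : Prop :=
  (lebesgue_Rn n).-integrable setT
    (EFin \o (fun x => h x * volume_density x)).

Definition g_integral (h : 'rV[R]_n -> R) : R :=
  \int[lebesgue_Rn n]_x (h x * volume_density x).

Definition sphere_flux (V : 'I_n -> 'rV[R]_n -> R) (r : R) : R :=
  sphere_integral r (fun x => \sum_i V i x * unit_normal x 0 i).

Definition adm_flux : R -> R :=
  sphere_flux (fun j x => \sum_i (dmetric i j i x - dmetric i i j x)).

Definition egb_flux (alpha : R) : R -> R :=
  sphere_flux (fun i x =>
    \sum_j (dmetric i j j x - dmetric j j i x) +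
    2 * alpha * \sum_j \sum_k \sum_l P_tensor i j k l x * dmetric j k l x).

Definition mass_constant : R := (2 * (n%:R - 1) * @sphere_area R n)^-1.

(* lim is a default value for a divergent flux: statements about the masses
   should also say that the flux converges. *)
Definition m_ADM : R := mass_constant * lim (adm_flux r @[r --> +oo]).

Definition m_EGB (alpha : R) : R :=
  mass_constant * lim (egb_flux alpha r @[r --> +oo]).

End curvature.

(* delta + df (x) df *)
Definition graph_metric {R : realType} {n : nat} (f : 'rV[R]_n -> R) :
    'rV[R]_n -> 'M[R]_n :=
  fun x => \matrix_(i, j) ((i == j)%:R + partial i f x * partial j f x).

(* Main.v *)
(* Put p = df, H = Hess f, W = 1 + |p|^2 and A = g^-1 H, a rank one update of H. The
   Riemann tensor is R_ijkl = W^-1 (H_ik H_jl - H_il H_jk), so that R and L_2 are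
   W^-1 sigma_2(A) and W^-2 sigma_4(A), where sigma_k is k! times the k-th elementary
   symmetric function of the eigenvalues. The Newton tensors N_1 and N_3 of the Hessian
   H are divergence free, and this gives R = div (W^-1 N_1 p), L_2 = div (W^-2 N_3 p).
   The first field differs from the ADM integrand, and the second field and the term
   P^ijkl g_jk,l from zero, by terms of order |x|^(-2 tau - 1) or smaller, whose flux
   through S_r vanishes in the limit since n - 1 < 2 tau + 1. The divergence theorem
   on balls then identifies both fluxes with the integral of R + alpha L_2 over R^n.
   Since the area measure of the sphere is defined by the volume of cones, the
   divergence theorem on the unit ball amounts to comparing a field V with the field
   x (V(x/|x|) . x/|x|), which has the same flux. *)

From HB Require Import structures.
Require Import Defs.
From mathcomp Require Import all_boot all_order all_algebra.
From mathcomp Require Import all_classical all_reals all_analysis.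
From mathcomp Require Import measurable_realfun.
From mathcomp Require Import ring lra.
Set Implicit Arguments.
Unset Strict Implicit.
Unset Printing Implicit Defensive.
Import Order.TTheory GRing.Theory Num.Theory.
Import numFieldNormedType.Exports.
Local Open Scope classical_set_scope.
Local Open Scope ring_scope.

(** The comparison field [x (V(x/|x|) . x/|x|)] is chosen because its radial factor is homogeneous
    of degree 0. By Euler's identity its divergence is [n] times that factor away from the origin,
    and the integral of this over the ball is the flux of [V], by the very definition of the area
    measure.

    Two obstacles shape the comparison. The boundary of the ball is not directly accessible: Fubini
    and the one-dimensional fundamental theorem only say that a partial derivative of a compactly
    supported function has integral zero. Both fields are therefore multiplied by cutoffs whose
    gradients blow up at the sphere; the limit survives because the normal components agree there,
    so that their difference is of the order of the distance to the sphere. Moreover the comparison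
    field is in general not C^1 at the origin, so it is regularized first, and this regularization
    is removed before the cutoff. *)

(** * Derivatives along lines and total derivatives *)

Lemma is_derive_affine {R : realType} {U V : normedModType R} (f : V -> R)
    (phi : U -> V) (u v : U) (w : V) (df : R) :
  (forall h : R, phi (h *: v + u) = h *: w + phi u) ->
  is_derive (phi u) w f df -> is_derive u v (f \o phi) df.
Proof.
move=> phiE [].
have E : (fun h : R => h^-1 *: (((f \o phi) \o shift u) (h *: v) - (f \o phi) u)) =
  (fun h : R => h^-1 *: ((f \o shift (phi u)) (h *: w) - f (phi u))).
  by apply/funext => h /=; rewrite phiE.
by rewrite /derivable /derive -E => ? ?; split.
Qed.

Section directional_derivatives.
Context {R : realType} {V : normedModType R}.
Implicit Types (f : V -> R) (x v : V).

Lemma is_derive_line f x v t : derivable f (x + t *: v) v ->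
  is_derive t 1 (fun s : R => f (x + s *: v)) ('D_v f (x + t *: v)).
Proof.
move=> /derivableP; apply: (@is_derive_affine _ _ _ f (fun s : R => x + s *: v)).
by move=> h; rewrite [h *: (1 : R)]mulr1 scalerDl addrCA.
Qed.

Lemma MVT_line f x v (t : R) : (forall s : R, derivable f (x + s *: v) v) ->
  exists2 c : R, `|c| <= `|t| & f (x + t *: v) - f x = t * 'D_v f (x + c *: v).
Proof.
move=> df.
have dl s := is_derive_line (df s).
have cl (A : set R) : {within A, continuous (fun s : R => f (x + s *: v))}.
  apply: continuous_subspaceT => s.
  apply: differentiable_continuous; apply/derivable1_diffP.
  by have := dl s => -[].
case: (lerP 0 t) => t0.
  have [c c01 E] := MVT_segment t0 (fun s _ => dl s) (cl _).
  exists c.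
    by move: c01; rewrite in_itv /= => /andP[c0 ct]; rewrite !ger0_norm.
  by move: E; rewrite scale0r addr0 subr0 mulrC.
have [c c01 E] := MVT_segment (ltW t0) (fun s _ => dl s) (cl _).
exists c.
  move: c01; rewrite in_itv /= => /andP[ct c0].
  by rewrite ler0_norm// ltr0_norm// lerN2.
by move: E; rewrite scale0r addr0 sub0r mulrN mulrC => /eqP; rewrite -eqr_oppLR opprB => /eqP ->.
Qed.

Lemma is_derive_of_line f x v (df : R) :
  is_derive (0 : R) 1 (fun s : R => f (x + s *: v)) df -> is_derive x v f df.
Proof.
have E : (fun h : R => h^-1 *: ((f \o shift x) (h *: v) - f x)) =
    (fun h => h^-1 *: (((fun s : R => f (x + s *: v)) \o shift 0) (h *: (1 : R))
      - f (x + 0 *: v))).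
  apply/funext => h.
  by rewrite /= scale0r addr0 [h *: (1 : R)]mulr1 addr0 [x + _]addrC.
by case=> d1 d2; split; rewrite /derivable /derive E.
Qed.

(** Restricted to the line through [x] along [v], this is the chain rule in one real variable. *)
Lemma is_derive_comp1 f (P : R -> R) x v (df dP : R) :
  is_derive x v f df -> is_derive (f x) 1 P dP ->
  is_derive x v (P \o f) (dP * df).
Proof.
move=> hf hP; apply: is_derive_of_line.
pose l (s : R) := x + s *: v.
have l0 : l 0 = x by rewrite /l scale0r addr0.
have dg : is_derive (0 : R) 1 (f \o l) df.
  apply: (@is_derive_affine _ _ _ f l _ _ v); last by rewrite l0.
  by move=> h; rewrite /l [h *: (1 : R)]mulr1 addr0 scale0r addr0 addrC.
have hP' : is_derive ((f \o l) 0) 1 P dP by rewrite /= l0.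
exact: (@is_derive1_comp _ P (f \o l) _ _ _ hP' dg).
Qed.

End directional_derivatives.

Lemma differentiable_epsP {R : realType} {V W : normedModType R} (f : V -> W)
    (df : {linear V -> W}) x : continuous df ->
  (forall e : R, 0 < e -> exists2 d : R, 0 < d & forall v : V,
    `|v| < d -> `|f (x + v) - f x - df v| <= e * `|v|) ->
  differentiable f x /\ 'd f x = df :> (V -> W).
Proof.
move=> cdf Hf.
have H : f \o shift x = cst (f x) + df +o_ 0 id.
  apply/eqaddoP => e /Hf[d d0 {}Hf]; near=> v.
  have -> : (f \o shift x - (cst (f x) + df)) v = f (x + v) - f x - df v.
    by rewrite -addrA -opprD [x + v]addrC.
  by apply: Hf; near: v; exact: nbhs0_lt.
split; last exact: diff_unique cdf H.
by apply/diff_locallyP; rewrite (diff_unique cdf H).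
Unshelve. all: by end_near. Qed.

(** * Partial derivatives and C^1 functions *)

Section partial_derivatives.
Context {R : realType} {n : nat}.
Implicit Types (f : 'rV[R]_n -> R) (x v : 'rV[R]_n).

Lemma continuous_rVP f x : {for x, continuous f} ->
  forall e : R, 0 < e -> exists2 d : R, 0 < d &
    forall y, `|y - x| < d -> `|f y - f x| < e.
Proof.
move=> cf e e0; have /cvgrPdist_lt /(_ e e0) := cf.
move=> /nbhs_ballP[d /= d0 H]; exists d => // y yx.
rewrite distrC; apply: H; rewrite -ball_normE /=.
by rewrite distrC.
Qed.

Lemma rV_normP x (e : R) : 0 <= e -> (`|x| <= e) <-> (forall i, `|x 0 i| <= e).
Proof.
move=> e0; rewrite [`|x|]mx_normrE; split.
  move=> H i; apply: le_trans H.
  exact: (le_bigmax _ (fun ij : 'I_1 * 'I_n => `|x ij.1 ij.2|) (0, i)).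
by move=> H; apply: bigmax_le => // -[i j] _ /=; rewrite ord1.
Qed.

Lemma coord_le_norm x i : `|x 0 i| <= `|x|.
Proof. by apply: (rV_normP x (normr_ge0 x)).1. Qed.

Definition dotr (a v : 'rV[R]_n) : R := \sum_i a 0 i * v 0 i.

Lemma dotr_is_linear a : linear (dotr a).
Proof.
move=> k u v; rewrite /dotr scaler_sumr -big_split /=; apply: eq_bigr => i _.
by rewrite !mxE mulrDr; congr (_ + _); rewrite mulrCA.
Qed.
HB.instance Definition _ a := GRing.isLinear.Build R 'rV[R]_n R _ (dotr a)
  (dotr_is_linear a).

Lemma continuous_coord i : continuous (fun x : 'rV[R]_n => x 0 i).
Proof. exact: coord_continuous. Qed.

Lemma continuous_bigsum (I : Type) (r : seq I) (P : pred I) (F : I -> 'rV[R]_n -> R) :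
  (forall i, P i -> continuous (F i)) ->
  continuous (fun x => \sum_(i <- r | P i) F i x).
Proof.
move=> cF; elim: r => [|i r IH] x.
  rewrite (_ : (fun _ => _) = cst 0); first exact: cst_continuous.
  by apply/funext => y; rewrite big_nil.
have [Pi|nPi] := boolP (P i).
  rewrite (_ : (fun _ => _) = F i \+ (fun x => \sum_(i <- r | P i) F i x)).
    exact: (continuousD (cF i Pi x) (IH x)).
  by apply/funext => y; rewrite big_cons Pi.
rewrite (_ : (fun _ => _) = (fun x => \sum_(i <- r | P i) F i x)); first exact: IH.
by apply/funext => y; rewrite big_cons (negbTE nPi).
Qed.

Lemma continuous_dotr a : continuous (dotr a).
Proof.
apply: continuous_bigsum => i _ x.
exact: (continuousM (@cst_continuous _ _ _ _) (@continuous_coord i x)).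
Qed.

(* Telescoping along the coordinates, with the mean value theorem at each step. *)
Lemma increment_bound f x (e d : R) : 0 <= e ->
  (forall i y, derivable f y (delta_mx 0 i)) ->
  (forall i y, `|y - x| <= d -> `|partial i f y - partial i f x| <= e) ->
  forall v, `|v| <= d ->
  `|f (x + v) - f x - dotr (grad f x) v| <= n%:R * e * `|v|.
Proof.
move=> e0 df H v vd.
pose w (k : nat) : 'rV[R]_n := \row_i (if (i < k)%N then v 0 i else 0).
have w0 : w 0%N = 0 by apply/rowP => i; rewrite !mxE.
have wn : w n = v by apply/rowP => i; rewrite !mxE ltn_ord.
have wS (i : 'I_n) : w i.+1 = w i + v 0 i *: delta_mx 0 i.
  apply/rowP => j; rewrite !mxE eqxx /= ltnS leq_eqVlt.
  have [->|ji] := eqVneq j i; first by rewrite ltnn eqxx mulr1 add0r.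
  by rewrite mulr0 addr0 (negbTE (_ : (val j != val i))).
have -> : f (x + v) - f x - dotr (grad f x) v =
    \sum_(i < n) (f (x + w i.+1) - f (x + w i) - partial i f x * v 0 i).
  rewrite sumrB; congr (_ - _); last by apply: eq_bigr => i _; rewrite mxE.
  rewrite -(big_mkord xpredT (fun i => f (x + w i.+1) - f (x + w i))).
  by rewrite telescope_sumr// w0 wn addr0.
apply: le_trans (ler_norm_sum _ _ _) _.
apply: le_trans (_ : \sum_(i < n) e * `|v| <= _); last first.
  by rewrite sumr_const card_ord -mulrA mulr_natl.
apply: ler_sum => i _.
rewrite wS addrA.
have [c cv ->] := @MVT_line R _ f (x + w i) (delta_mx 0 i) (v 0 i)
  (fun s => df i _).
rewrite [_ * v 0 i]mulrC -mulrBr normrM mulrC.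
apply: ler_pM => //; last exact: coord_le_norm.
(* Truncating coordinates does not increase the sup norm, so the whole path stays within [|v|] of
   [x]. *)
apply: H; apply: le_trans vd.
rewrite -(addrA x) [x + _]addrC addrK.
apply/rV_normP => // j; rewrite !mxE eqxx /=.
have [->|ji] := eqVneq j i.
  by rewrite ltnn mulr1 add0r (le_trans cv)// coord_le_norm.
by rewrite mulr0 addr0; case: ifP => _; [exact: coord_le_norm|rewrite normr0].
Qed.

Lemma C1_differentiable f x :
  (forall i y, derivable f y (delta_mx 0 i)) ->
  (forall i, {for x, continuous (partial i f)}) ->
  differentiable f x /\ 'd f x = dotr (grad f x) :> (_ -> _).
Proof.
move=> df cf.
apply: (@differentiable_epsP _ _ _ f (dotr (grad f x))) => [|e e0].
  exact: continuous_dotr.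
  (* [increment_bound] costs a factor [n]; dividing by [n%:R + 1] absorbs it, also when [n] is 0. *)
  have e1 : 0 < e / (n%:R + 1) by rewrite divr_gt0// ltr_wpDl.
  have {}cf i := continuous_rVP (cf i) e1.
  have [d d0 Hd] : exists2 d : R, 0 < d & forall i y, `|y - x| < d ->
      `|partial i f y - partial i f x| < e / (n%:R + 1).
    exists (\big[Order.min/1]_i (sval (cid2 (cf i)))).
      by apply/bigmin_gtP; split => // i _; case: cid2.
    move=> i y yx; have := svalP (cid2 (cf i)) => /= -[_]; apply.
    by apply: lt_le_trans yx _; exact: bigmin_le_cond.
  exists (d / 2) => [|v vd]; first by rewrite divr_gt0.
  apply: le_trans (@increment_bound f x (e / (n%:R + 1)) (d / 2) _ df _ v _) _.
  - exact: ltW.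
  - move=> i y yd; apply/ltW/Hd; apply: le_lt_trans yd _.
    by rewrite ltr_pdivrMr// ltr_pMr// ltr1n.
  - exact: ltW.
  rewrite ler_wpM2r// mulrCA ler_piMr// ?ltW//.
  by rewrite ltr_pdivrMr ?ltr_wpDl// mul1r ltrDl.
Qed.

(** The second difference [D] is symmetric in the two directions. Two applications of the mean value
    theorem turn it into [t * t] times either mixed derivative at a point close to [x], and
    continuity of both at [x] concludes. *)
Lemma partial_comm f i j x :
  (forall k y, derivable f y (delta_mx 0 k)) ->
  (forall k l y, derivable (partial k f) y (delta_mx 0 l)) ->
  continuous (partial i (partial j f)) -> continuous (partial j (partial i f)) ->
  partial i (partial j f) x = partial j (partial i f) x.
Proof.
move=> df ddf cij cji.
pose ei : 'rV[R]_n := delta_mx 0 i; pose ej : 'rV[R]_n := delta_mx 0 j.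
pose D (k l : 'I_n) (t : R) := f (x + t *: delta_mx 0 k + t *: delta_mx 0 l)
  - f (x + t *: delta_mx 0 k) - (f (x + t *: delta_mx 0 l) - f x).
have DE k l (t : R) : exists2 y, `|y - x| <= `|t| + `|t| &
    D k l t = t * (t * partial l (partial k f) y).
  pose h y := f (y + t *: delta_mx 0 l) - f y.
  have hd y : is_derive y (delta_mx 0 k) h
      (partial k f (y + t *: delta_mx 0 l) - partial k f y).
    apply: is_deriveB; last exact/derivableP/df.
    apply: (@is_derive_affine _ _ _ f (fun y => y + t *: delta_mx 0 l)).
      by move=> s; rewrite addrA.
    exact/derivableP/df.
  have [c ct E1] := @MVT_line R _ h x (delta_mx 0 k) t (fun s => @ex_derive _ _ _ _ _ _ _ (hd _)).
  have [c' ct' E2] := @MVT_line R _ (partial k f) (x + c *: delta_mx 0 k)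
    (delta_mx 0 l) t (fun s => ddf k l _).
  exists (x + c *: delta_mx 0 k + c' *: delta_mx 0 l); last first.
    rewrite /D; transitivity (h (x + t *: delta_mx 0 k) - h x) => //.
    by rewrite E1 derive_val E2.
  rewrite -(addrA x) [x + _]addrC addrK; apply: le_trans (ler_normD _ _) _.
  have N1 (m : 'I_n) : `|delta_mx 0 m : 'rV[R]_n| <= 1.
    apply/rV_normP => // p; rewrite mxE eqxx /=.
    by case: (p == m); rewrite ?normr1 ?normr0.
  by apply: lerD; rewrite normrZ (le_trans (ler_piMr _ (N1 _))).
have DC t : D i j t = D j i t.
  by rewrite /D (addrAC x (t *: delta_mx 0 i)); ring.
apply/eqP; rewrite -subr_eq0 -normr_le0; apply/ler_addgt0Pl => e e0.
rewrite addr0; have e2 : 0 < e / 2 by rewrite divr_gt0.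
have [d1 d10 H1] := continuous_rVP (cij x) e2.
have [d2 d20 H2] := continuous_rVP (cji x) e2.
(* The intermediate points lie within [2 t] of [x]; a quarter of the smaller radius leaves a strict
   inequality. *)
pose t := Order.min d1 d2 / 4.
have t0 : 0 < t by rewrite divr_gt0// lt_min d10.
have tt y : `|y - x| <= `|t| + `|t| -> `|y - x| < d1 /\ `|y - x| < d2.
  move=> H; suff : `|y - x| < Order.min d1 d2 by rewrite lt_min => /andP.
  by apply: le_lt_trans H _; rewrite gtr0_norm//; move: t0; rewrite /t; lra.
have [y1 /tt[y1d _] E1] := DE j i t; have [y2 /tt[_ y2d] E2] := DE i j t.
move: (DC t); rewrite E1 E2 => /(mulfI (lt0r_neq0 t0))/(mulfI (lt0r_neq0 t0)) E.
have A := H1 _ y1d; have B := H2 _ y2d; move: A B; rewrite -E.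
move: (partial j (partial i f) y2) => a.
move: (partial i _ x) (partial j _ x) => b c A B; clear -A B.
rewrite distrC in A; apply: le_trans (ler_distD a _ _) _; rewrite [e]splitr.
exact: lerD (ltW _) (ltW _).
Qed.

(* [du i] is the i-th partial derivative of the C^1 function [u]. *)
Definition C1 (u : 'rV[R]_n -> R) (du : 'I_n -> 'rV[R]_n -> R) : Prop :=
  forall i, continuous (du i) /\
    forall x : 'rV[R]_n, is_derive x (delta_mx 0 i : 'rV[R]_n) u (du i x).

Implicit Types (u w : 'rV[R]_n -> R) (du dw : 'I_n -> 'rV[R]_n -> R).

Lemma C1_partial u du : C1 u du -> forall i, partial i u = du i.
Proof.
by move=> uC i; apply/funext => x; have [_ /(_ x)[_ <-]] := uC i.
Qed.

Lemma C1_diff u du x : C1 u du ->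
  differentiable u x /\ forall v, 'd u x v = \sum_i du i x * v 0 i.
Proof.
move=> uC; have [||? dE] := @C1_differentiable u x.
- by move=> i y; have [_ /(_ y)[]] := uC i.
- by move=> i; rewrite (C1_partial uC); have [+ _] := uC i; apply.
split=> // v; rewrite dE; apply: eq_bigr => i _.
by rewrite mxE (C1_partial uC).
Qed.

Lemma C1_continuous u du : C1 u du -> continuous u.
Proof. by move=> uC x; apply/differentiable_continuous; case: (C1_diff x uC). Qed.

Lemma C1_cst (a : R) : C1 (cst a) (fun=> cst 0).
Proof. by move=> i; split=> [|x]; [exact: cst_continuous|exact: is_derive_cst]. Qed.

Lemma C1_coord k : C1 (fun x => x 0 k) (fun i => cst (i == k)%:R).
Proof.
move=> i; split=> [|x]; first exact: cst_continuous.
apply: is_derive_of_line; rewrite /cst.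
have -> : (fun s : R => (x + s *: (delta_mx 0 i : 'rV[R]_n)) 0 k) =
    (fun s => x 0 k + s * (i == k)%:R).
  by apply/funext => s; rewrite !mxE eqxx /= [k == i]eq_sym.
have H := is_deriveD (is_derive_cst (x 0 k) (0 : R) (1 : R)) (is_deriveM
  (is_derive_id (0 : R) (1 : R)) (is_derive_cst ((i == k)%:R : R) (0 : R) (1 : R))).
by apply: (is_derive_eq H); rewrite scaler0 !add0r [_ *: 1]mulr1.
Qed.

Lemma C1_eq u du w dw : C1 u du -> u =1 w -> (forall i, du i =1 dw i) -> C1 w dw.
Proof.
move=> uC uw duw i; have -> : dw i = du i by apply/esym/funext/duw.
by have <- : u = w by apply/funext.
Qed.

Lemma C1D u du w dw : C1 u du -> C1 w dw ->
  C1 (fun x => u x + w x) (fun i x => du i x + dw i x).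
Proof.
move=> uC vC i; have [uc ud] := uC i; have [vc vd] := vC i; split=> x.
  exact: continuousD (uc x) (vc x).
exact: is_deriveD.
Qed.

Lemma C1M u du w dw : C1 u du -> C1 w dw ->
  C1 (fun x => u x * w x) (fun i x => u x * dw i x + w x * du i x).
Proof.
move=> uC vC i; have [uc ud] := uC i; have [vc vd] := vC i; split=> x.
  have cu := @C1_continuous _ _ uC x; have cw := @C1_continuous _ _ vC x.
  exact: (continuousD (continuousM cu (vc x)) (continuousM cw (uc x))).
exact: is_deriveM.
Qed.

Lemma C1_sum (I : Type) (r : seq I) (F : I -> 'rV[R]_n -> R) dF :
  (forall k, C1 (F k) (dF k)) ->
  C1 (fun x => \sum_(k <- r) F k x) (fun i x => \sum_(k <- r) dF k i x).
Proof.
move=> FC; elim: r => [|k r IH].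
  apply: C1_eq (C1_cst 0) _ _ => [x|i x]; by rewrite big_nil.
by apply: C1_eq (C1D (FC k) IH) _ _ => [x|i x]; rewrite big_cons.
Qed.

Lemma C1_comp1 u du (P dP : R -> R) : C1 u du ->
  (forall x, is_derive (u x) 1 P (dP (u x))) ->
  (forall x, {for u x, continuous dP}) ->
  C1 (fun x => P (u x)) (fun i x => dP (u x) * du i x).
Proof.
move=> uC PE cP i; have [uc ud] := uC i; split=> x; last exact: is_derive_comp1.
have cu := @C1_continuous _ _ uC x.
exact: (continuousM (continuous_comp cu (cP x)) (uc x)).
Qed.

Lemma continuous_rV (psi : 'rV[R]_n -> 'rV[R]_n) :
  (forall k, continuous (fun x => psi x 0 k)) -> continuous psi.
Proof.
move=> cpsi x; have FF : Filter (nbhs x) by exact: nbhs_filter.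
apply/(@cvgrPdist_le _ _ _ (nbhs x)) => e e0.
have H : \forall y \near nbhs x, forall k, `|psi x 0 k - psi y 0 k| <= e.
  apply: filter_forall => k.
  by have /cvgrPdist_le /(_ _ e0) := cpsi k x.
apply: filterS H => y H; apply/rV_normP => [|k]; first exact: ltW.
by rewrite !mxE.
Qed.

(** On a coordinate line the inner map becomes a curve, differentiable because its coordinates are;
    [u] is differentiable by [C1_diff], so the differentials compose. *)
Lemma C1_comp (psi : 'rV[R]_n -> 'rV[R]_n) dpsi u du :
  (forall k, C1 (fun x => psi x 0 k) (dpsi k)) -> C1 u du ->
  C1 (fun x => u (psi x)) (fun i x => \sum_k du k (psi x) * dpsi k i x).
Proof.
move=> psiC uC i.
have cpsi : continuous psi.
  by apply: continuous_rV => k; exact: C1_continuous (psiC k).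
split=> [|x].
  apply: continuous_bigsum => k _ x; have [ck _] := uC k; have [cp _] := psiC k i.
  exact: (continuousM (continuous_comp (cpsi x) (ck (psi x))) (cp x)).
apply: is_derive_of_line.
pose g (s : R) := psi (x + s *: delta_mx 0 i).
have g0 : g 0 = psi x by rewrite /g scale0r addr0.
have gd k : is_derive (0 : R) 1 (fun s => g s 0 k) (dpsi k i x).
  have [_ /(_ x) [d e]] := psiC k i; rewrite -e.
  have := @is_derive_line R _ (fun x => psi x 0 k) x (delta_mx 0 i) 0.
  by rewrite scale0r addr0; apply.
have dg : derivable g 0 1.
  by apply/derivable_mxP => a k; rewrite (ord1 a); case: (gd k).
have Dg : 'D_1 g 0 = \row_k dpsi k i x.
  rewrite derive_mx//; apply/matrixP => a k; rewrite !mxE (ord1 a).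
  by case: (gd k).
have [du0 duE] := C1_diff (g 0) uC.
have dg' : differentiable g 0 by apply/derivable1_diffP.
have dug : differentiable (u \o g) 0 by exact: differentiable_comp.
split; first exact: diff_derivable.
have Dg' : 'd g 0 1 = \row_k dpsi k i x by rewrite -deriveE.
rewrite (_ : (fun s : R => _) = u \o g)// deriveE// diff_comp//= Dg' duE g0.
by apply: eq_bigr => k _; rewrite mxE.
Qed.

End partial_derivatives.

(** * Borel measurability of continuous functions *)

Section borel_measurability.
Context {R : realType} {n : nat}.

(** The sigma-algebra is generated by the coordinates, so boxes are measurable; an open set is the
    countable union of the boxes with rational center and radius [k.+1%:R^-1] that it contains,
    enumerated through [unpickle]. *)
Lemma open_measurable_rV (U : set 'rV[R]_n) : open U -> measurable U.
Proof.
move=> oU.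
pose box (q : 'rV[rat]_n) (k : nat) : set 'rV[R]_n :=
  [set x | forall i, `|x 0 i - ratr (q 0 i)| < k.+1%:R^-1].
pose A (m : nat) : set 'rV[R]_n :=
  if unpickle m is Some (q, k) then
    (if `[< box q k `<=` U >] then box q k else set0) else set0.
have mbox q k : measurable (box q k).
  have -> : box q k = \bigcap_(i in [set: 'I_n])
      [set x | `|x 0 i - ratr (q 0 i)| < k.+1%:R^-1].
    by apply/seteqP; split => x /= H i; [move=> _|]; exact: H.
  apply: fin_bigcap_measurable => // i _.
  have mi : measurable_fun setT (fun x : 'rV[R]_n => `|x 0 i - ratr (q 0 i)|).
    apply: measurableT_comp => //.
    by apply: measurable_funB; [exact: measurable_coord|exact: measurable_cst].
  rewrite [X in measurable X](_ : _ = setT `&`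
    (fun x : 'rV[R]_n => `|x 0 i - ratr (q 0 i)|) @^-1` `]-oo, k.+1%:R^-1[%classic).
    exact: mi.
  by rewrite setTI; apply/seteqP; split => x /=; rewrite in_itv.
have -> : U = \bigcup_m A m.
  apply/seteqP; split => [x Ux|x]; last first.
    move=> [m _]; rewrite /A; case: unpickle => // -[q k].
    by case: ifPn => // /asboolP; exact.
  have := open_nbhs_nbhs (conj oU Ux).
  move=> /nbhs_ballP[e /= e0 xeU].
  (* Half of [e], because two points of a box are compared through its center. *)
  have [k ke] : exists k : nat, k.+1%:R^-1 < e / 2.
    have /ltr_add_invr [k Hk] : (0 : R) < e / 2 by rewrite divr_gt0.
    by exists k; rewrite add0r in Hk.
  have k0 : (0 : R) < k.+1%:R^-1 by rewrite invr_gt0.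
  have qP i : exists q : rat, `|x 0 i - ratr q| < k.+1%:R^-1.
    have [|q] := @rat_in_itvoo R (x 0 i - k.+1%:R^-1) (x 0 i + k.+1%:R^-1).
      by rewrite ltrBlDr -addrA ltrDl addr_gt0.
    rewrite in_itv /= => /andP[q1 q2]; exists q.
    by rewrite ltr_distlC q1.
  pose q : 'rV[rat]_n := \row_i sval (cid (qP i)).
  exists (pickle (q, k)) => //; rewrite /A pickleK.
  have bx : box q k x by move=> i; rewrite mxE; exact: svalP (cid (qP i)).
  rewrite ifT//; apply/asboolP => y by_; apply: xeU.
  rewrite -ball_normE /=; apply: le_lt_trans (_ : k.+1%:R^-1 + k.+1%:R^-1 < e); last first.
    by rewrite [e]splitr ltrD.
  apply/rV_normP => [|i]; first by rewrite addr_ge0// ltW.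
  rewrite !mxE; apply: le_trans (ler_distD (ratr (q 0 i)) _ _) _.
  by apply: lerD; apply: ltW; [exact: bx|rewrite distrC; exact: by_].
apply: bigcup_measurable => m _; rewrite /A.
by case: unpickle => // -[q k]; case: ifP.
Qed.

Lemma continuous_measurable_rV (u : 'rV[R]_n -> R) :
  continuous u -> measurable_fun setT u.
Proof.
move=> /continuousP cu; apply: (measurability _ (RGenOpens.measurableE R)).
move=> _ [_ [a [b ->] <-]]; rewrite setTI; apply: open_measurable_rV.
exact/cu/interval_open.
Qed.

End borel_measurability.

(** * Lebesgue measure on R^n and changes of variables *)

Section lebesgue_Rn_theory.
Context {R : realType}.
Local Open Scope ereal_scope.

Definition box (n : nat) (M : R) : set 'rV[R]_n :=
  [set x | forall i, (`|x 0%R i| <= M)%R].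
Arguments box : clear implicits.

Lemma measurable_box n M : measurable (box n M).
Proof.
have -> : box n M = \bigcap_(i in [set: 'I_n]) [set x | (`|x 0%R i| <= M)%R].
  by apply/seteqP; split => x /= H i; [move=> _|]; exact: H.
apply: fin_bigcap_measurable => // i _.
have mi : measurable_fun setT (fun x : 'rV[R]_n => `|x 0%R i|%R).
  by apply: measurableT_comp => //; exact: measurable_coord.
rewrite [X in measurable X](_ : _ = setT `&`
  (fun x : 'rV[R]_n => `|x 0%R i|%R) @^-1` `]-oo, M]%classic); first exact: mi.
by rewrite setTI; apply/seteqP; split => x /=; rewrite in_itv.
Qed.

Lemma box_lty n M : lebesgue_Rn n (box n M) < +oo.
Proof.
elim: n => [|n IH]; first by rewrite /= diracE ltry.
rewrite /= /lebesgue_consr /pushforward.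
have -> : @consr R n @^-1` box n.+1 M = `[(- M)%R, M]%classic `*` box n M.
  apply/seteqP; split => -[t y] /=.
    move=> H; split; last by move=> i; have := H (lift ord0 i); rewrite consr_lift.
    by have := H 0%R; rewrite consr0 /= ler_norml in_itv.
  move=> [tM yM] i; have [j ->|->] := unliftP ord0 i.
    by rewrite consr_lift.
  by rewrite consr0 ler_norml; move: tM; rewrite in_itv.
rewrite product_measure1E//; last exact: measurable_box.
rewrite lte_mul_pinfty// ge0_fin_numE//.
by rewrite /= lebesgue_measure_itv; case: ifP => // _; rewrite -EFinB ltry.
Qed.

Lemma measurable_consrR n :
  measurable_fun [set: measurableTypeR R * 'rV[R]_n] (@consr R n).
Proof. exact: measurable_consr. Qed.

Lemma ge0_integral_Rn1 n (F : 'rV[R]_n.+1 -> \bar R) :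
  measurable_fun setT F -> (forall x, 0 <= F x) ->
  \int[lebesgue_Rn n.+1]_x F x =
  \int[@lebesgue_measure R]_t \int[lebesgue_Rn n]_y F (consr (t, y)).
Proof.
move=> mF F0.
have mc := measurableT_comp mF (@measurable_consrR n).
have := @ge0_integral_pushforward _ _ (measurableTypeR R * 'rV[R]_n)%type
  'rV[R]_n.+1 R (@consr R n) (@measurable_consrR n)
  (@lebesgue_measure R \x lebesgue_Rn n) setT F measurableT mF (fun x _ => F0 x).
move=> E; rewrite [LHS]E preimage_setT; apply: fubini_tonelli1 => // x.
exact: F0.
Qed.

(** Uniqueness of Lebesgue measure: [r] times its image under the dilation by [r] gives every
    half-open interval its length. *)
Lemma ge0_integral_scale1 (r : R) (F : R -> \bar R) : (0 < r)%R ->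
  measurable_fun setT F -> (forall x, 0 <= F x) ->
  \int[lebesgue_measure]_t F t = r%:E * \int[lebesgue_measure]_t F (r * t)%R.
Proof.
move=> r0 mF F0.
have mphi : measurable_fun setT (fun t : measurableTypeR R => (r * t)%R : measurableTypeR R).
  by apply: continuous_measurable_fun; exact: mulrl_continuous.
pose mu0 : {measure set (measurableTypeR R) -> \bar R} :=
  mscale (NngNum (ltW r0)) (pushforward (@lebesgue_measure R)
    (fun t : measurableTypeR R => (r * t)%R : measurableTypeR R)).
pose mu := mu0 mphi.
have leb_mu (A : set (measurableTypeR R)) : measurable A -> lebesgue_measure A = mu A.
  move=> mA; apply: lebesgue_measure_unique => // X [[a b] _ <-] /=.
  rewrite /mu /mscale /= /pushforward.
  have -> : (fun t : R => (r * t)%R) @^-1` `]a, b]%classic = `](a / r)%R, (b / r)%R]%classic.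
    apply/seteqP; split => t; rewrite /= !in_itv /= ltr_pdivrMr// ler_pdivlMr//;
    by rewrite [(t * r)%R]mulrC.
  rewrite !lebesgue_measure_itv /= !lte_fin ltr_pM2r ?invr_gt0//.
  case: ifP => _; last by rewrite mule0.
  by rewrite -!EFinB -EFinM -mulrBl mulrC divfK// gt_eqF.
rewrite (eq_measure_integral mu) => [|A mA _]; last exact: leb_mu.
rewrite ge0_integral_mscale//; congr (_ * _).
by rewrite ge0_integral_pushforward// preimage_setT.
Qed.

Lemma ge0_integral_scale n (r : R) (F : 'rV[R]_n -> \bar R) : (0 < r)%R ->
  measurable_fun setT F -> (forall x, 0 <= F x) ->
  \int[lebesgue_Rn n]_x F x = (r ^+ n)%:E * \int[lebesgue_Rn n]_x F (r *: x)%R.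
Proof.
move=> r0; elim: n F => [|n IH] F mF F0.
  rewrite expr0 mul1e; apply: eq_integral => x _; congr F.
  by apply/rowP => -[].
have mscale m : measurable_fun setT (fun x : 'rV[R]_m => (r *: x)%R).
  apply: measurable_fun_coordP => i.
  under eq_fun do rewrite mxE.
  by apply: measurable_funM; [exact: measurable_cst|exact: measurable_coord].
have consrZ t y : consr ((r * t)%R, (r *: y)%R) = (r *: consr (t, y))%R :> 'rV[R]_n.+1.
  apply/rowP => i; have [j ->|->] := unliftP ord0 i.
    by rewrite [in RHS]mxE !consr_lift /= mxE.
  by rewrite [in RHS]mxE !consr0.
have mFc : measurable_fun setT (F \o @consr R n).
  by apply: measurableT_comp => //; exact: measurable_consrR.
have mFy t : measurable_fun setT (fun y => F (consr (t, y))).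
  exact: (measurableT_comp mFc (pair1_measurable t)).
rewrite ge0_integral_Rn1//.
under eq_integral => t _ do rewrite IH//.
have mI : measurable_fun setT (fun t => \int[lebesgue_Rn n]_y F (consr (t, r *: y)%R)).
  apply: (@measurable_fun_fubini_tonelli_F _ _ _ _ _ (lebesgue_Rn n)
    (fun p => F (consr (p.1, r *: p.2)%R))) => //.
  apply: (measurableT_comp mFc); apply: measurable_fun_pair => //.
  exact: (measurableT_comp (mscale n)).
have I0 t : 0 <= \int[lebesgue_Rn n]_y F (consr (t, r *: y)%R).
  exact: integral_ge0.
rewrite ge0_integralZl//; last by rewrite lee_fin exprn_ge0// ltW.
rewrite (ge0_integral_scale1 r0)// exprSr EFinM -muleA; congr (_ * (_ * _)).
have mFr : measurable_fun setT (fun x : 'rV[R]_n.+1 => F (r *: x)%R).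
  exact: (measurableT_comp mF (mscale n.+1)).
rewrite (ge0_integral_Rn1 mFr) => [|x]; last exact: F0.
apply: eq_integral => t _; apply: eq_integral => y _.
by rewrite consrZ.
Qed.

End lebesgue_Rn_theory.
Arguments box {R} n M.

Section transfer_of_integrals.
Context d1 d2 (T1 : measurableType d1) (T2 : measurableType d2) (R : realType).
Variables (m1 : {measure set T1 -> \bar R}) (m2 : {measure set T2 -> \bar R}).
Variables (D : set T2) (phi : T2 -> T1) (c : R).
Hypothesis c0 : 0 <= c.
Hypothesis mD : measurable D.
Hypothesis transfer : forall F : T1 -> \bar R, measurable_fun setT F ->
  (forall x, (0 <= F x)%E) ->
  (\int[m1]_x F x = c%:E * \int[m2]_(x in D) F (phi x))%E.

(** A change of variables known for nonnegative functions is applied to the positive and negative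
    parts; integrability on the right makes these integrals finite, so that [c] distributes over
    their difference. *)
Lemma Rintegral_transfer (u : T1 -> R) : measurable_fun setT u ->
  m2.-integrable D (EFin \o (u \o phi)) ->
  \int[m1]_x u x = c * \int[m2]_(x in D) u (phi x).
Proof.
move=> mu iu; rewrite /Rintegral.
suff -> : (\int[m1]_x (u x)%:E = c%:E * \int[m2]_(x in D) (u (phi x))%:E)%E.
  by rewrite fineM//; exact: integrable_fin_num iu.
have mu' : measurable_fun setT (EFin \o u) by exact/measurable_EFinP.
rewrite [LHS]integralE [in RHS]integralE.
rewrite (transfer (measurable_funepos mu'))// (transfer (measurable_funeneg mu'))//.
rewrite [in RHS]muleBr//; last first.
  by apply: fin_num_adde_defr; apply: (integrable_pos_fin_num mD); exact: iu.
by congr (_ * _ - _ * _)%E; apply: eq_integral => x _; rewrite ?funeposE ?funenegE.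
Qed.

End transfer_of_integrals.

(** * Integrals of derivatives of compactly supported functions *)

Section vanishing_integral.
Context {R : realType}.

Lemma bounded_integrable d (T : measurableType d) (mu : {measure set T -> \bar R})
    (D : set T) (u : T -> R) (C : R) : measurable D -> (mu D < +oo)%E ->
  measurable_fun D u -> (forall x, D x -> `|u x| <= C) ->
  mu.-integrable D (EFin \o u).
Proof.
move=> mD Doo mu' uC; apply: measurable_bounded_integrable => //.
exists C; split; first exact: num_real.
by move=> M CM x Dx; apply: le_trans (uC _ Dx) (ltW CM).
Qed.

Lemma integrable_bounded_support d (T : measurableType d)
    (mu : {measure set T -> \bar R}) (D : set T) (u : T -> R) (C : R) :
  measurable D -> (mu D < +oo)%E -> measurable_fun setT u ->
  (forall x, `|u x| <= C) -> (forall x, ~ D x -> u x = 0) ->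
  mu.-integrable setT (EFin \o u).
Proof.
move=> mD Doo mu' uC u0.
have -> : EFin \o u = (EFin \o u) \_ D.
  apply/funext => x; rewrite patchE; case: ifPn => // /negP xD /=.
  by rewrite u0// => Dx; apply: xD; rewrite inE.
apply/(integrable_mkcond _ mD).1.
exact: (bounded_integrable mD Doo (measurable_funTS mu') (fun x _ => uC x)).
Qed.

(* The integrand vanishes outside a compact interval, so the integral of the
   derivative is a difference of two zero boundary values. *)
Lemma integral_derive_compact (g dg : R -> R) (M : R) :
  (forall t : R, is_derive t (1 : R) g (dg t)) -> continuous dg ->
  (forall t, M < `|t| -> g t = 0) -> (forall t, M < `|t| -> dg t = 0) ->
  (\int[@lebesgue_measure R]_t (dg t)%:E = 0)%E.
Proof.
move=> dgE cdg g0 dg0.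
(* The strict margin over [M] makes [g] vanish at both endpoints, and the interval is nondegenerate
   even for negative [M]. *)
pose N := `|M| + 1.
have MN : M < N by rewrite (le_lt_trans (ler_norm M))// ltrDl.
have N0 : 0 < N by rewrite ltr_wpDl.
have cg : continuous g.
  by move=> t; apply/differentiable_continuous/derivable1_diffP; case: (dgE t).
have -> : (\int[@lebesgue_measure R]_t (dg t)%:E =
           \int[@lebesgue_measure R]_(t in `[(- N)%R, N]) (dg t)%:E)%E.
  rewrite [RHS]integral_mkcond; apply: eq_integral => t _.
  rewrite patchE; case: ifPn => // /negP tN; rewrite dg0//.
  apply: lt_le_trans MN _; rewrite leNgt; apply/negP => tN'; apply: tN.
  by rewrite inE /= in_itv /= -ler_norml ltW.
rewrite (@continuous_FTC2 R dg g (- N) N).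
- rewrite !g0 ?subee// ?normrN gtr0_norm//.
- by rewrite ltrNl (lt_trans _ N0)// oppr_lt0.
- exact: continuous_subspaceT.
- split; first by move=> t _; case: (dgE t).
  + exact: cvg_at_right_filter (cg _).
  + exact: cvg_at_left_filter (cg _).
- by move=> t _; rewrite derive1E; case: (dgE t).
Qed.

Lemma consr_line n (t : R) (y : 'rV[R]_n) (h : R) :
  consr (t + h, y) = consr (t, y) + h *: delta_mx 0 0.
Proof.
apply/rowP => i; rewrite !mxE eqxx /=; have [j ->|->] := unliftP ord0 i.
  by rewrite (_ : (lift ord0 j == 0) = false)// mulr0 addr0.
by rewrite /= mulr1.
Qed.

Lemma consr_lift_line n (t : R) (y : 'rV[R]_n) (h : R) (j : 'I_n) :
  consr (t, y + h *: delta_mx 0 j) = consr (t, y) + h *: delta_mx 0 (lift ord0 j).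
Proof.
apply/rowP => i; rewrite !mxE eqxx /=; have [k ->|->] := unliftP ord0 i.
  by rewrite /= !mxE eqxx /= (inj_eq (@lift_inj _ ord0)).
by rewrite /= mulr0 addr0.
Qed.

(** Fubini, with the differentiated coordinate innermost. If [i] is not the first coordinate, the
    first one is integrated last and the induction hypothesis applies to the slices; otherwise the
    slices are functions of one real variable. *)
Lemma integral_partial_compact n (i : 'I_n) (u du : 'rV[R]_n -> R) (M C : R) :
  (forall x, is_derive x (delta_mx 0 i) u (du x)) ->
  (forall x, continuous (fun t : R => du (x + t *: delta_mx 0 i))) ->
  measurable_fun setT du -> (forall x, `|du x| <= C) ->
  (forall x, ~ box n M x -> u x = 0) -> (forall x, ~ box n M x -> du x = 0) ->
  (\int[lebesgue_Rn n]_x (du x)%:E = 0)%E.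
Proof.
elim: n i u du => [[]//|n IH] i u du dE cdu mdu duC u0 du0.
have mc := measurableT_comp mdu (@measurable_consrR R n).
pose mu := (@lebesgue_measure R \x lebesgue_Rn n)%E.
have ic : mu.-integrable setT (EFin \o (du \o @consr R n)).
  apply: (@integrable_bounded_support _ _ mu (@consr R n @^-1` box n.+1 M) _ C) => //.
  - by rewrite -[X in measurable X]setTI; apply: measurable_consrR => //; exact: measurable_box.
  - exact: (box_lty n.+1 M).
  - by move=> p; exact: duC.
  - by move=> p; exact: du0.
have -> : (\int[lebesgue_Rn n.+1]_x (du x)%:E = \int[mu]_p (du (consr p))%:E)%E.
  have := @integral_pushforward _ _ (measurableTypeR R * 'rV[R]_n)%type
    'rV[R]_n.+1 R (@consr R n) (@measurable_consrR R n) mu setT (EFin \o du) _ _ measurableT.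
  rewrite preimage_setT; apply; last exact: ic.
  exact/measurable_EFinP.
have [j ij|ij] := unliftP ord0 i; subst i.
  rewrite -(integral12_prod_meas1 ic); apply: integral0_eq => t _.
  apply: (IH j (fun y => u (consr (t, y))) (fun y => du (consr (t, y)))).
  - move=> y; apply: (is_derive_affine (phi := fun y => consr (t, y))) (dE _).
    by move=> h; rewrite addrC consr_lift_line addrC.
  - move=> y; have := cdu (consr (t, y)).
    by under eq_fun do rewrite -consr_lift_line.
  - exact: (measurableT_comp mc (pair1_measurable t)).
  - by move=> y; exact: duC.
  - move=> y yM; apply: u0 => H; apply: yM => k.
    by have := H (lift ord0 k); rewrite consr_lift.
  - move=> y yM; apply: du0 => H; apply: yM => k.
    by have := H (lift ord0 k); rewrite consr_lift.
rewrite -(integral21_prod_meas1 ic); apply: integral0_eq => y _.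
have out t : M < `|t| -> ~ box n.+1 M (consr (t, y)).
  by move=> Mt /(_ 0); rewrite consr0 /= leNgt Mt.
apply: (@integral_derive_compact (fun t => u (consr (t, y))) _ M).
- move=> t; apply: (is_derive_affine (phi := fun t => consr (t, y))) (dE _).
  by move=> h; rewrite [h *: (1 : R)]mulr1 addrC consr_line addrC.
- have := cdu (consr (0, y)).
  by under eq_fun do rewrite -consr_line add0r.
- by move=> t Mt; apply: u0; exact: out.
- by move=> t Mt; apply: du0; exact: out.
Qed.

End vanishing_integral.

(** * Integration over the unit ball *)

Section unit_ball.
Context {R : realType} {n : nat}.
Implicit Types (x : 'rV[R]_n) (u w : 'rV[R]_n -> R).
Local Notation mu := (lebesgue_Rn n : {measure set 'rV[R]_n -> \bar R}).
Local Notation B := (@unit_ball R n).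

Definition sqnorm x : R := \sum_i x 0 i ^+ 2.

Lemma sqnorm_ge0 x : 0 <= sqnorm x.
Proof. by apply: sumr_ge0 => i _; exact: sqr_ge0. Qed.

Lemma enorm_ge0 x : 0 <= enorm x. Proof. exact: sqrtr_ge0. Qed.

Lemma enorm_sqr x : enorm x ^+ 2 = sqnorm x.
Proof. by rewrite sqr_sqrtr// sqnorm_ge0. Qed.

Lemma sqnormZ (r : R) x : sqnorm (r *: x) = r ^+ 2 * sqnorm x.
Proof. by rewrite mulr_sumr; apply: eq_bigr => i _; rewrite mxE exprMn. Qed.

Lemma enormZ (r : R) x : 0 <= r -> enorm (r *: x) = r * enorm x.
Proof.
by move=> r0; rewrite /enorm -/(sqnorm _) sqnormZ sqrtrM ?sqr_ge0// sqrtr_sqr ger0_norm.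
Qed.

Lemma sqnorm_eq0 x : (sqnorm x == 0) = (x == 0).
Proof.
apply/idP/eqP => [|->]; last by rewrite /sqnorm big1// => i _; rewrite mxE expr0n.
rewrite psumr_eq0 => [/allP H|i _]; last exact: sqr_ge0.
apply/rowP => i; have := H i (mem_index_enum i).
by rewrite mxE sqrf_eq0 => /eqP.
Qed.

Lemma enorm_eq0 x : (enorm x == 0) = (x == 0).
Proof. by rewrite -sqnorm_eq0 -enorm_sqr sqrf_eq0. Qed.

Lemma enorm_gt0 x : (0 < enorm x) = (x != 0).
Proof. by rewrite lt_def enorm_eq0 enorm_ge0 andbT. Qed.

Lemma coord_le_enorm x i : `|x 0 i| <= enorm x.
Proof.
rewrite -sqrtr_sqr ler_sqrt ?sqnorm_ge0// (bigD1 i)//= lerDl.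
by apply: sumr_ge0 => j _; exact: sqr_ge0.
Qed.

Lemma unit_ballE x : B x <-> sqnorm x <= 1.
Proof. by rewrite /unit_ball /= /enorm -{1}sqrtr1 ler_sqrt. Qed.

Lemma unit_ball_box x : B x -> box n 1 x.
Proof. by move=> Bx i; exact: le_trans (coord_le_enorm x i) Bx. Qed.

Lemma unit_ball_lty : (mu B < +oo)%E.
Proof.
apply: le_lt_trans (box_lty n 1); apply: le_measure; rewrite ?inE.
- exact: measurable_unit_ball.
- exact: measurable_box.
- exact: unit_ball_box.
Qed.

Lemma box_bounded (M : R) u : continuous u ->
  exists2 C : R, 0 <= C & forall x, box n M x -> `|u x| <= C.
Proof.
move=> cu.
have cb : compact (box n M).
  have -> : box n M = [set v : 'rV[R]_n | forall i,
      (fun=> `[(- M), M]%classic) i (v ord0 i)].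
    by apply/seteqP; split=> x /= H i; have := H i; rewrite in_itv /= ler_norml.
  apply: (@rV_compact _ n (fun=> `[(- M), M]%classic)) => _.
  exact: segment_compact.
have /compact_bounded[C [_ HC]] := continuous_compact (continuous_subspaceT cu) cb.
exists `|C + 1| => // x bx.
apply: le_trans (HC (C + 1) _ (u x) _) (ler_norm _); last by exists x.
by rewrite ltrDl.
Qed.

(** A class stable under sums and products that contains the continuous functions, and also
    functions of [x/|x|] such as [G] below, in general discontinuous at the origin. *)
Definition BM u : Prop := measurable_fun setT u /\
  exists2 C : R, 0 <= C & forall x, B x -> `|u x| <= C.

Lemma BM_integrable u : BM u -> mu.-integrable B (EFin \o u).
Proof.
move=> [mu' [C _ uC]]; apply: bounded_integrable unit_ball_lty _ uC.
  exact: measurable_unit_ball.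
exact: measurable_funTS.
Qed.

Lemma BM_continuous u : continuous u -> BM u.
Proof.
move=> cu; split; first exact: continuous_measurable_rV.
have [C C0 HC] := box_bounded 1 cu.
by exists C => // x /unit_ball_box; exact: HC.
Qed.

Lemma BM_D u w : BM u -> BM w -> BM (fun x => u x + w x).
Proof.
move=> [mu' [C C0 HC]] [mw [D D0 HD]]; split; first exact: measurable_funD.
exists (C + D) => [|x Bx]; first exact: addr_ge0.
by apply: le_trans (ler_normD _ _) _; apply: lerD; [exact: HC|exact: HD].
Qed.

Lemma BM_M u w : BM u -> BM w -> BM (fun x => u x * w x).
Proof.
move=> [mu' [C C0 HC]] [mw [D D0 HD]]; split; first exact: measurable_funM.
exists (C * D) => [|x Bx]; first exact: mulr_ge0.
by rewrite normrM; apply: ler_pM => //; [exact: HC|exact: HD].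
Qed.

Lemma BM_cst a : BM (cst a).
Proof. by apply: BM_continuous; exact: cst_continuous. Qed.

Lemma BM_N u : BM u -> BM (fun x => - u x).
Proof.
move=> [mu' [C C0 HC]]; split; last by exists C => // x; rewrite normrN; exact: HC.
exact: measurableT_comp.
Qed.

Lemma BM_B u w : BM u -> BM w -> BM (fun x => u x - w x).
Proof. by move=> hu /BM_N; exact: BM_D. Qed.

Lemma BM_sum (I : Type) (r : seq I) (F : I -> 'rV[R]_n -> R) :
  (forall i, BM (F i)) -> BM (fun x => \sum_(i <- r) F i x).
Proof.
move=> HF; elim: r => [|i r IH].
  by under eq_fun do rewrite big_nil; exact: BM_cst.
by under eq_fun do rewrite big_cons; exact: BM_D.
Qed.

Lemma Rintegral_BM_sum (I : Type) (r : seq I) (F : I -> 'rV[R]_n -> R) :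
  (forall i, BM (F i)) ->
  \int[mu]_(x in B) (\sum_(i <- r) F i x) = \sum_(i <- r) \int[mu]_(x in B) F i x.
Proof.
move=> HF; elim: r => [|i r IH].
  rewrite big_nil; under eq_Rintegral do rewrite big_nil.
  by rewrite Rintegral_cst ?mul0r//; exact: measurable_unit_ball.
rewrite big_cons -IH -RintegralD.
- by apply: eq_Rintegral => x _; rewrite big_cons.
- exact: measurable_unit_ball.
- exact: BM_integrable.
- by apply: BM_integrable; exact: BM_sum.
Qed.

Lemma bounded_cvg (u_ : nat -> 'rV[R]_n -> R) u (C : R) :
  (forall m, measurable_fun setT (u_ m)) -> measurable_fun setT u ->
  (forall m x, B x -> `|u_ m x| <= C) ->
  (forall x, B x -> u_ m x @[m --> \oo] --> u x) ->
  \int[mu]_(x in B) u_ m x @[m --> \oo] --> \int[mu]_(x in B) u x.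
Proof.
move=> mu_ mu' uC cu.
have mB : measurable B by exact: measurable_unit_ball.
have [|||||iu _ H] := @dominated_convergence _ _ R mu B mB
  (fun m => EFin \o u_ m) (EFin \o u) (cst C%:E).
- by move=> m; apply/measurable_EFinP; exact: measurable_funTS.
- by apply/measurable_EFinP; exact: measurable_funTS.
- by apply: aeW => x Bx; apply: cvg_EFin; [exact: nearW|exact: cu].
- have := @BM_integrable (cst C) (BM_cst C); exact.
- by apply: aeW => x m Bx; rewrite lee_fin; exact: uC.
have fi := integrable_fin_num mB iu.
by rewrite -(fineK fi) in H; exact: fine_cvg H.
Qed.

Lemma Rintegral_partial_ball (i : 'I_n) u du : C1 u du ->
  (forall x, ~ B x -> u x = 0) -> (forall x, ~ B x -> du i x = 0) ->
  \int[mu]_(x in B) du i x = 0.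
Proof.
move=> uC u0 du0.
have [cdu ud] := uC i.
have [C C0 HC] := box_bounded 1 cdu.
have duC x : `|du i x| <= C.
  have [Bx|nBx] := pselect (B x); first by apply/HC/unit_ball_box.
  by rewrite du0// normr0.
rewrite Rintegral_mkcond /Rintegral.
have -> : (fun x => ((du i \_ B) x)%:E) = EFin \o du i.
  apply/funext => x /=; rewrite patchE; case: ifPn => // /negP xB.
  by rewrite du0// => Bx; apply: xB; rewrite inE.
rewrite (@integral_partial_compact _ _ i u (du i) 1 C)//.
- move=> x t; apply: continuous_comp; last exact: cdu.
  exact: (continuousD (@cst_continuous _ _ x t) (@scalel_continuous _ _ (delta_mx 0 i) t)).
- exact: continuous_measurable_rV.
- by move=> x nb; apply: u0 => /unit_ball_box.
- by move=> x nb; apply: du0 => /unit_ball_box.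
Qed.

End unit_ball.

(** * Cutoffs and a regularization of the unit normal *)

Section cutoff_functions.
Context {R : realType}.
Implicit Types a z : R.

Definition pos (a : R) : R := Num.max a 0.

Lemma pos_continuous : continuous pos.
Proof. by move=> a; exact: (@continuous_max R R id (cst 0) a (fun A h => h) (@cst_continuous _ _ 0 a)). Qed.

(** The square of the positive part, unlike the positive part, is C^1, whence its use in the
    cutoffs. At 0 its Carathéodory slope function is [pos] itself. *)
Lemma is_derive_sqr_pos a : is_derive a 1 (fun z => z * pos z) (2 * pos a).
Proof.
have idc : {for a, continuous (@id R)} by [].
have cc := @cst_continuous R R 0 a.
have [a0|a0|->] := ltgtP a 0.
- have D : is_derive a 1 (id \max cst 0 : R -> R) 0.
    split; last by rewrite derive_maxr// derive_cst.
    by apply: derivable_max => //; rewrite /= /cst lt_eqF.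
  apply: (is_derive_eq (is_deriveM (is_derive_id a 1) D)).
  by rewrite /= /pos /cst max_r ?ltW// scaler0 scale0r mulr0 addr0.
- have D : is_derive a 1 (id \max cst 0 : R -> R) 1.
    split; last by rewrite derive_maxl// derive_id.
    by apply: derivable_max => //; rewrite /= /cst gt_eqF.
  apply: (is_derive_eq (is_deriveM (is_derive_id a 1) D)).
  rewrite /= /pos /cst max_l ?ltW//.
  by rewrite ![_ *: 1]mulr1 mulr_natl mulr2n.
- apply/is_derive1_caratheodory; exists pos; split.
  + by move=> z; rewrite mul0r !subr0 mulrC.
  + exact: pos_continuous.
  + by rewrite /pos maxxx mulr0.
Qed.

Lemma is_derive_invsqrt (e a : R) : 0 < a + e ->
  is_derive a 1 (fun z => (Num.sqrt (z + e))^-1)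
    (- 2^-1 * (Num.sqrt (a + e))^-1 ^+ 3).
Proof.
move=> ae.
have s0 : Num.sqrt (a + e) != 0 by rewrite gt_eqF// sqrtr_gt0.
have D : is_derive a 1 (Num.sqrt \o (fun z => z + e)) ((2 * Num.sqrt (a + e))^-1 * 1).
  apply: is_derive_comp1; last exact: is_derive1_sqrt.
  have := is_deriveD (is_derive_id a 1) (is_derive_cst e a 1).
  by rewrite addr0.
apply: (is_derive_eq (@is_deriveV _ (Num.sqrt \o (fun z => z + e)) a _ 1 s0 D)).
rewrite /= mulr1 /GRing.scale /= invfM !exprVn.
by field.
Qed.

(** Each of the [m.+1] terms of the geometric sum [1 + s + ... + s ^+ m] is at least [s ^+ m]. The
    bound is uniform in [m], as dominated convergence will require. *)
Lemma natmul_expr_le1 (m : nat) (s : R) : 0 <= s <= 1 ->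
  m.+1%:R * s ^+ m * (1 - s) <= 1.
Proof.
move=> /andP[s0 s1].
have H : (1 - s) * \sum_(i < m.+1) s ^+ i = 1 - s ^+ m.+1.
  by rewrite -opprB mulNr -subrX1 opprB.
apply: le_trans (_ : 1 - s ^+ m.+1 <= _); last by rewrite gerBl exprn_ge0.
rewrite -H mulrC ler_wpM2l ?subr_ge0//.
apply: le_trans (_ : \sum_(i < m.+1) s ^+ m <= _).
  by rewrite sumr_const card_ord mulr_natl.
by apply: ler_sum => i _; apply: ler_wiXn2l => //; rewrite -ltnS.
Qed.

(** With [s = q * q], the bound [natmul_expr_le1] at [q] absorbs the factor [m.+1] together with one
    power [q ^+ m]; the other power tends to 0. *)
Lemma cvg_natmul_expr (s : R) : 0 <= s < 1 ->
  m.+1%:R * s ^+ m @[m --> \oo] --> 0.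
Proof.
move=> /andP[s0 s1].
pose q := Num.sqrt s.
have q0 : 0 <= q by exact: sqrtr_ge0.
have q1 : q < 1 by rewrite -sqrtr1 ltr_sqrt.
have qs : s = q * q by rewrite -expr2 sqr_sqrtr.
have cq : q ^+ m * (1 - q)^-1 @[m --> \oo] --> 0.
  rewrite -[X in _ --> X](mul0r (1 - q)^-1).
  by apply: cvgM; [apply: cvg_expr; rewrite ger0_norm|exact: cvg_cst].
apply: (@squeeze_cvgr _ _ _ _ (cst 0) (fun m => q ^+ m * (1 - q)^-1)) => //; last first.
  exact: cvg_cst.
apply: nearW => m; rewrite /cst mulr_ge0 ?exprn_ge0//=.
rewrite qs exprMn mulrA mulrC ler_wpM2l ?exprn_ge0//.
rewrite -[leRHS]mul1r ler_pdivlMr ?subr_gt0//.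
by apply: natmul_expr_le1; rewrite q0 ltW.
Qed.

End cutoff_functions.

Lemma sum_delta {R : pzSemiRingType} {n : nat} (F : 'I_n -> R) (i : 'I_n) :
  \sum_k F k * (i == k)%:R = F i.
Proof.
rewrite (bigD1 i)//= eqxx mulr1 big1 ?addr0// => k ki.
by rewrite eq_sym (negbTE ki) mulr0.
Qed.

Section sqnorm_calculus.
Context {R : realType} {n : nat}.
Implicit Types x : 'rV[R]_n.

Lemma C1_sqnorm : C1 (@sqnorm R n) (fun i x => 2 * x 0 i).
Proof.
apply: C1_eq (C1_sum _ (fun k => C1M (C1_coord k) (C1_coord k))) _ _ => [x|i x].
  by apply: eq_bigr => k _; rewrite expr2.
by rewrite big_split /= /cst sum_delta mulr_natl mulr2n.
Qed.

(* C^1 cutoffs, increasing with [m] to the indicator of the open unit ball. *)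
Definition eta (m : nat) x : R := (1 - sqnorm x ^+ m.+1) * pos (1 - sqnorm x ^+ m.+1).

Definition deta (m : nat) (i : 'I_n) x : R :=
  2 * pos (1 - sqnorm x ^+ m.+1) * - (m.+1%:R * sqnorm x ^+ m * (2 * x 0 i)).

Lemma C1_eta m : C1 (eta m) (deta m).
Proof.
have C : C1 (fun x => 1 - sqnorm x ^+ m.+1)
    (fun i x => - (m.+1%:R * sqnorm x ^+ m) * (2 * x 0 i)).
  apply: (C1_comp1 (P := fun a => 1 - a ^+ m.+1)
    (dP := fun a => - (m.+1%:R * a ^+ m)) C1_sqnorm) => x.
    have := is_deriveB (is_derive_cst (1 : R) (sqnorm x) (1 : R))
      (is_deriveX m.+1 (is_derive_id (sqnorm x) (1 : R))).
    have -> : cst 1 - id ^+ m.+1 = (fun a : R => 1 - a ^+ m.+1).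
      by apply/funext => a; rewrite -[LHS]/(1 - (id ^+ m.+1 : R -> R) a) exprfctE.
    by rewrite sub0r [_ *: 1]mulr1.
  apply: continuousN; apply: continuousM; first exact: cst_continuous.
  exact: exprn_continuous.
apply: C1_eq (C1_comp1 (P := fun a => a * pos a) (dP := fun a => 2 * pos a) C _ _) _ _.
- by move=> x; exact: is_derive_sqr_pos.
- move=> x; apply: continuousM; first exact: cst_continuous.
  exact: pos_continuous.
- by [].
- by move=> i x; rewrite /deta !mulNr.
Qed.

Lemma eta_out m x : ~ unit_ball x -> pos (1 - sqnorm x ^+ m.+1) = 0.
Proof.
move=> /unit_ballE/negP; rewrite -ltNge => s1.
by apply/max_r; rewrite subr_le0 exprn_ege1// ltW.
Qed.

Lemma eta_in m x : unit_ball x -> pos (1 - sqnorm x ^+ m.+1) = 1 - sqnorm x ^+ m.+1.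
Proof.
by move=> /unit_ballE s1; apply/max_l; rewrite subr_ge0 exprn_ile1// sqnorm_ge0.
Qed.

(* [psi k] below is a C^1 approximation x / sqrt (|x|^2 + eps) of [unit_normal]. *)
Definition eps (k : nat) : R := k.+1%:R^-1.

Lemma eps_gt0 k : 0 < eps k. Proof. by rewrite invr_gt0. Qed.

Definition cinv (k : nat) x : R := (Num.sqrt (sqnorm x + eps k))^-1.

Lemma cinv_sqr k x : cinv k x ^+ 2 * (sqnorm x + eps k) = 1.
Proof.
have s0 : 0 < sqnorm x + eps k by rewrite ltr_wpDl ?sqnorm_ge0// eps_gt0.
by rewrite /cinv exprVn sqr_sqrtr ?ltW// mulVf// gt_eqF.
Qed.

Lemma C1_cinv k : C1 (cinv k) (fun i x => - cinv k x ^+ 3 * x 0 i).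
Proof.
have s0 x : 0 < sqnorm x + eps k by rewrite ltr_wpDl ?sqnorm_ge0// eps_gt0.
have H := C1_comp1 (P := fun a => (Num.sqrt (a + eps k))^-1)
  (dP := fun a => - 2^-1 * (Num.sqrt (a + eps k))^-1 ^+ 3) C1_sqnorm.
apply: C1_eq (H _ _) _ _ => //.
- by move=> x; exact: is_derive_invsqrt.
- move=> x; apply: continuousM; first exact: cst_continuous.
  apply: (continuous_comp (f := fun a => (Num.sqrt (a + eps k))^-1) (g := fun b => b ^+ 3)).
    apply/differentiable_continuous/derivable1_diffP.
    by have [] := is_derive_invsqrt (s0 x).
  exact: exprn_continuous.
- move=> i x; rewrite /cinv; set c := (Num.sqrt _)^-1.
  by field.
Qed.

Definition psi (k : nat) x : 'rV[R]_n := cinv k x *: x.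

Lemma psi_ball k x : unit_ball (psi k x).
Proof.
apply/unit_ballE; rewrite sqnormZ -(cinv_sqr k x) ler_wpM2l ?sqr_ge0//.
by rewrite lerDl ltW// eps_gt0.
Qed.

Lemma C1_psi k j : C1 (fun x => psi k x 0 j)
  (fun i x => cinv k x * (i == j)%:R + x 0 j * (- cinv k x ^+ 3 * x 0 i)).
Proof.
by apply: C1_eq (C1M (C1_cinv k) (C1_coord j)) _ _ => // x; rewrite mxE.
Qed.

End sqnorm_calculus.

Lemma ler_norm_mul {R : numDomainType} (a b A B : R) :
  `|a| <= A -> `|b| <= B -> `|a * b| <= A * B.
Proof. by move=> aA bB; rewrite normrM ler_pM. Qed.

Lemma ler_norm_add {R : numDomainType} (a b A B : R) :
  `|a| <= A -> `|b| <= B -> `|a + b| <= A + B.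
Proof. by move=> aA bB; apply: le_trans (ler_normD _ _) (lerD aA bB). Qed.

(** * The unit sphere has measure zero *)

Section unit_sphere_null.
Context {R : realType} {n : nat}.
Local Notation mu := (lebesgue_Rn n : {measure set 'rV[R]_n -> \bar R}).
Local Notation B := (@unit_ball R n).

Definition open_unit_ball : set 'rV[R]_n := [set x | sqnorm x < 1].

Lemma measurable_open_unit_ball : measurable open_unit_ball.
Proof.
rewrite [X in measurable X](_ : _ = setT `&` @sqnorm R n @^-1` `]-oo, 1[%classic).
  have ms := continuous_measurable_rV (C1_continuous (@C1_sqnorm R n)).
  by apply: ms => //; exact: measurable_itv.
by rewrite setTI; apply/seteqP; split => x /=; rewrite in_itv.
Qed.

Lemma indic_open_unit_ball x : (sqnorm x < 1)%R%:R = \1_open_unit_ball x :> R.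
Proof. by rewrite indicE; congr ((nat_of_bool _)%:R); apply/idP/idP; rewrite inE. Qed.

Lemma sub_open_unit_ball : open_unit_ball `<=` B.
Proof. by move=> x x1; apply/unit_ballE/ltW. Qed.

Lemma unit_ball_dilation (r : R) : 0 < r < 1 ->
  ((r ^+ n)%:E * mu B <= mu open_unit_ball)%E.
Proof.
move=> /andP[r0 r1].
have mB : measurable B by exact: measurable_unit_ball.
have mO := measurable_open_unit_ball.
pose F (x : 'rV[R]_n) : \bar R := (\1_open_unit_ball x)%:E.
have mF : measurable_fun setT F by exact/measurable_EFinP.
have -> : mu open_unit_ball = (\int[mu]_x F x)%E.
  by rewrite /F integral_indic// setIT.
rewrite (ge0_integral_scale r0 mF) => [|x]; last by rewrite lee_fin.
rewrite lee_pmul2l ?lte_fin ?exprn_gt0//.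
have -> : mu B = (\int[mu]_x ((\1_B x : R)%:E))%E by rewrite integral_indic// setIT.
apply: ge0_le_integral => //.
- exact/measurable_EFinP.
- apply: (measurableT_comp mF); apply: measurable_fun_coordP => i.
  under eq_fun do rewrite mxE.
  by apply: measurable_funM; [exact: measurable_cst|exact: measurable_coord].
- move=> x _; rewrite lee_fin /F !indicE.
  case: (boolP (x \in B)) => //; rewrite inE => /unit_ballE x1.
  rewrite mem_set//= /open_unit_ball /= sqnormZ.
  apply: (@le_lt_trans _ _ (r ^+ 2)); last by rewrite expr_lt1// ltW.
  by rewrite ler_piMr// sqr_ge0.
Qed.

(** The open ball contains the closed one shrunk by [1 - e], and Bernoulli's inequality bounds the
    volume lost by [n%:R * b * e]. *)
Lemma unit_sphere_null : mu (B `\` open_unit_ball) = 0%E.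
Proof.
have mB : measurable B by exact: measurable_unit_ball.
have mO := measurable_open_unit_ball.
have fB : (mu B \is a fin_num)%E by rewrite ge0_fin_numE// unit_ball_lty.
have fO : (mu open_unit_ball \is a fin_num)%E.
  rewrite ge0_fin_numE//; apply: le_lt_trans unit_ball_lty.
  by apply: le_measure; rewrite ?inE//; exact: sub_open_unit_ball.
rewrite measureD//; last by rewrite unit_ball_lty.
rewrite (setIidr sub_open_unit_ball).
pose b := fine (mu B); pose a := fine (mu open_unit_ball).
have bE : mu B = b%:E by rewrite fineK.
have aE : mu open_unit_ball = a%:E by rewrite fineK.
have b0 : 0 <= b by rewrite fine_ge0.
have ab : a <= b.
  by rewrite -lee_fin -aE -bE; apply: le_measure; rewrite ?inE//; exact: sub_open_unit_ball.
transitivity (b%:E - a%:E)%E; first by rewrite -bE -aE.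
rewrite -EFinB; congr EFin; apply/eqP; rewrite eq_le subr_ge0 ab andbT.
have bernoulli (e : R) : 0 <= e <= 1 -> forall k, 1 - k%:R * e <= (1 - e) ^+ k.
  move=> /andP[e0 e1]; elim=> [|k IH]; first by rewrite mul0r subr0 expr0.
  rewrite exprS; apply: le_trans (_ : (1 - e) * (1 - k%:R * e) <= _); last first.
    by rewrite ler_wpM2l// subr_ge0.
  rewrite -natr1 -subr_ge0.
  have -> : (1 - e) * (1 - k%:R * e) - (1 - (k%:R + 1) * e) = k%:R * e ^+ 2 by ring.
  by rewrite mulr_ge0// sqr_ge0.
have H (e : R) : 0 < e < 1 -> b - a <= n%:R * b * e.
  move=> /andP[e0 e1].
  have /unit_ball_dilation : 0 < 1 - e < 1 by rewrite subr_gt0 e1 gtrBl.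
  rewrite bE aE -EFinM lee_fin => H.
  have e01 : 0 <= e <= 1 by rewrite !ltW.
  have := le_trans (ler_wpM2r b0 (bernoulli e e01 n)) H.
  by rewrite mulrBl mul1r lerBlDr => H'; rewrite lerBlDl mulrAC.
apply/ler_addgt0Pl => z z0; rewrite addr0.
have nb : 0 <= n%:R * b by rewrite mulr_ge0.
(* The minimum with [2^-1] keeps [e] below 1, and the [+ 1] keeps the denominator positive. *)
pose e := Num.min 2^-1 (z / (n%:R * b + 1)).
have e01 : 0 < e < 1.
  rewrite /e lt_min gt_min invr_gt0 ltr0n /= divr_gt0 ?ltr_wpDl//=.
  by rewrite invf_lt1 ?ltr1n.
apply: le_trans (H e e01) _.
apply: le_trans (_ : n%:R * b * (z / (n%:R * b + 1)) <= _).
  by apply: ler_wpM2l => //; rewrite /e ge_min lexx orbT.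
rewrite mulrCA ler_piMr ?ltW// ltr_pdivrMr ?ltr_wpDl// mul1r ltrDl//.
Qed.

(** The cutoffs converge to the indicator of the open ball, whereas the area measure is defined with
    the closed one. *)
Lemma Rintegral_open_unit_ball (w : 'rV[R]_n -> R) : measurable_fun setT w ->
  \int[mu]_(x in B) ((sqnorm x < 1)%R%:R * w x) = \int[mu]_(x in B) w x.
Proof.
move=> mw; congr fine.
have mB : measurable B by exact: measurable_unit_ball.
have mO := measurable_open_unit_ball.
apply: ae_eq_integral => //.
- apply/measurable_EFinP/measurable_funTS; apply: measurable_funM => //.
  rewrite (_ : (fun x => _) = \1_open_unit_ball)//.
  by apply/funext => x; exact: indic_open_unit_ball.
- by apply/measurable_EFinP; exact: measurable_funTS.
exists (B `\` open_unit_ball); split; [exact: measurableD|exact: unit_sphere_null|].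
move=> x /= H; apply: contrapT => nx; apply: H => Bx.
have -> : sqnorm x < 1; last by rewrite mul1r.
by apply: contrapT => ns; apply: nx.
Qed.

End unit_sphere_null.

(** * The divergence theorem *)

Section divergence_unit_ball.
Context {R : realType} {n : nat}.
Implicit Types x : 'rV[R]_n.
Local Notation mu := (lebesgue_Rn n : {measure set 'rV[R]_n -> \bar R}).
Local Notation B := (@unit_ball R n).

(** Integration by parts without boundary term: [eta m * V] and its first derivatives vanish outside
    the ball. *)
Lemma cutoff_divergence (V : 'I_n -> 'rV[R]_n -> R) (dV : 'I_n -> 'I_n -> 'rV[R]_n -> R)
    (m : nat) : (forall i, C1 (V i) (dV i)) ->
  \int[mu]_(x in B) (eta m x * (\sum_i dV i i x) + \sum_i V i x * deta m i x) = 0.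
Proof.
move=> hV.
have H i := C1M (C1_eta m) (hV i).
transitivity (\int[mu]_(x in B)
    (\sum_i (eta m x * dV i i x + V i x * deta m i x))).
  by apply: eq_Rintegral => x _; rewrite mulr_sumr big_split.
rewrite Rintegral_BM_sum => [|i]; last first.
  by apply: BM_continuous; have [] := H i i.
apply: big1 => i _.
apply: (Rintegral_partial_ball (H i)) => x nB.
  by rewrite /eta eta_out// mulr0 mul0r.
by rewrite /eta /deta eta_out// !(mulr0, mul0r) addr0.
Qed.

Variables (V : 'I_n -> 'rV[R]_n -> R) (dV : 'I_n -> 'I_n -> 'rV[R]_n -> R).
Hypothesis hV : forall i, C1 (V i) (dV i).

(** On the unit sphere [K] is the normal component of [V]; [G] extends these boundary values
    homogeneously of degree 0, and [flow] is the radial derivative [x . grad K]. *)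
Let K x := \sum_k V k x * x 0 k.
Let dK i x := \sum_k (V k x * (i == k)%:R + x 0 k * dV k i x).
Let divV x := \sum_i dV i i x.
Let flow x := \sum_j dK j x * x 0 j.
Let G x := K (unit_normal x).
Let Gk k x := K (psi k x).

Let C1_K : C1 K dK.
Proof. exact: (C1_sum _ (fun k => C1M (hV k) (C1_coord k))). Qed.

Let cK : continuous K. Proof. exact: C1_continuous C1_K. Qed.

Let cdK i : continuous (dK i). Proof. by have [] := C1_K i. Qed.

Let cflow : continuous flow.
Proof.
apply: continuous_bigsum => j _ x.
exact: (continuousM (@cdK j x) (@continuous_coord _ _ j x)).
Qed.

Let C1_Gk k := C1_comp (C1_psi k) C1_K.

(* Euler's identity up to an error that vanishes with [eps k]: [Gk k] is almost
   homogeneous of degree 0. *)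
Let radial_Gk k x :
  \sum_i x 0 i * (\sum_j dK j (psi k x) *
    (cinv k x * (i == j)%:R + x 0 j * (- cinv k x ^+ 3 * x 0 i))) =
  eps k * cinv k x ^+ 2 * flow (psi k x).
Proof.
have E : eps k * cinv k x ^+ 2 = 1 - cinv k x ^+ 2 * sqnorm x.
  by rewrite -(cinv_sqr k x); ring.
rewrite E /flow mulr_sumr.
under eq_bigr do rewrite mulr_sumr.
rewrite exchange_big /=; apply: eq_bigr => j _; rewrite [psi k x 0 j]mxE.
transitivity (dK j (psi k x) * cinv k x * (\sum_i x 0 i * (j == i)%:R) -
    dK j (psi k x) * cinv k x ^+ 3 * x 0 j * sqnorm x).
  rewrite /sqnorm !mulr_sumr -sumrB; apply: eq_bigr => i _.
  by rewrite [j == i]eq_sym; ring.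
by rewrite sum_delta; ring.
Qed.

Let mG : measurable_fun setT G.
Proof.
exact: (measurableT_comp (continuous_measurable_rV cK) (@measurable_unit_normal R n)).
Qed.

Let unit_normal_ball x : B (unit_normal x).
Proof.
rewrite /unit_ball /= enormZ ?invr_ge0 ?enorm_ge0//.
have [->|x0] := eqVneq (enorm x) 0; first by rewrite mulr0 ler01.
by rewrite mulVf.
Qed.

Let K0 : K 0 = 0.
Proof. by rewrite /K big1// => k _; rewrite mxE mulr0. Qed.

Let unit_normal0 : unit_normal 0 = 0 :> 'rV[R]_n.
Proof. by rewrite /unit_normal scaler0. Qed.

Let eps_cvg0 : @eps R k @[k --> \oo] --> 0.
Proof. exact: cvg_harmonic. Qed.

Let Gk_cvg x : Gk k x @[k --> \oo] --> G x.
Proof.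
have [->|x0] := eqVneq x 0.
  rewrite /G /Gk unit_normal0 (_ : (fun k => _) = cst (K 0)); first exact: cvg_cst.
  by apply/funext => k; rewrite /psi scaler0.
have s0 : 0 < sqnorm x by rewrite lt_def sqnorm_ge0 sqnorm_eq0 x0.
have cc : cinv k x @[k --> \oo] --> (enorm x)^-1.
  have cs : sqnorm x + @eps R k @[k --> \oo] --> sqnorm x.
    rewrite -[X in _ --> X]addr0; apply: cvgD eps_cvg0; exact: cvg_cst.
  apply: cvgV; first by rewrite enorm_eq0.
  exact: (cvg_comp _ _ cs (@sqrt_continuous R (sqnorm x))).
have cp : psi k x @[k --> \oo] --> unit_normal x by exact: cvgZr_tmp.
exact: (cvg_comp _ _ cp (@cK (unit_normal x))).
Qed.

Let flow_cvg x : eps k * cinv k x ^+ 2 * flow (psi k x) @[k --> \oo] --> (0 : R).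
Proof.
have [C C0 HC] := box_bounded 1 cflow.
(* At the origin [eps k * cinv k x ^+ 2] equals 1 for every [k]; the product still vanishes, because
   [flow 0] does. *)
have [->|x0] := eqVneq x 0.
  have flow0 : flow 0 = 0 by rewrite /flow big1// => j _; rewrite mxE mulr0.
  rewrite (_ : (fun k => _) = cst 0); first exact: cvg_cst.
  by apply/funext => k; rewrite /psi scaler0 flow0 mulr0.
have s0 : 0 < sqnorm x by rewrite lt_def sqnorm_ge0 sqnorm_eq0 x0.
have c2 k : cinv k x ^+ 2 <= (sqnorm x)^-1.
  rewrite -[leRHS]mulr1 ler_pdivlMl// -(cinv_sqr k x) mulrC.
  by rewrite ler_wpM2l ?sqr_ge0// lerDl ltW// eps_gt0.
have c0 : @eps R k * ((sqnorm x)^-1 * C) @[k --> \oo] --> 0.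
  rewrite -[X in _ --> X](mul0r ((sqnorm x)^-1 * C)).
  by apply: cvgM eps_cvg0 _; exact: cvg_cst.
apply/norm_cvg0P/(squeeze_cvgr _ (cvg_cst 0) c0).
apply: nearW => k; rewrite normr_ge0 /= -mulrA normrM (ger0_norm (ltW (eps_gt0 k))).
apply: ler_wpM2l; first exact/ltW/eps_gt0.
rewrite normrM; apply: ler_pM => //; first by rewrite ger0_norm ?sqr_ge0.
by apply: HC; apply: unit_ball_box; exact: psi_ball.
Qed.

(** This is [cutoff_divergence] for the fields [x * Gk k x], in the limit in [k]. Their divergence
    is [n * Gk k] plus the radial derivative of [Gk k], which by [radial_Gk] tends to 0 pointwise
    and stays bounded. *)
Let radial_identity m : \int[mu]_(x in B)
  (eta m x * (n%:R * G x) + (\sum_i x 0 i * deta m i x) * G x) = 0.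
Proof.
pose D x := \sum_i x 0 i * deta m i x.
pose F k x := eta m x * (n%:R * Gk k x + eps k * cinv k x ^+ 2 * flow (psi k x))
  + D x * Gk k x.
have cD : continuous D.
  apply: continuous_bigsum => i _ x; have [cd _] := @C1_eta R n m i.
  exact: (continuousM (@continuous_coord _ _ i x) (cd x)).
have ceta : continuous (@eta R n m) by exact: (C1_continuous (@C1_eta R n m)).
have F0 k : \int[mu]_(x in B) F k x = 0.
  have := cutoff_divergence m (fun i => C1M (C1_coord i) (C1_Gk k)).
  move=> <-; apply: eq_Rintegral => x _; rewrite /F /D; congr (_ * _ + _).
    rewrite big_split /= radial_Gk addrC; congr (_ + _).
    under eq_bigr do rewrite /cst eqxx mulr1.
    by rewrite sumr_const card_ord mulr_natl.
  by rewrite mulr_suml; apply: eq_bigr => i _; rewrite /Gk; ring.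
have [Ce Ce0 He] := box_bounded 1 ceta.
have [Cd Cd0 Hd] := box_bounded 1 cD.
have [CK CK0 HK] := box_bounded 1 cK.
have [Cf Cf0 Hf] := box_bounded 1 cflow.
have cGk k : continuous (Gk k) by exact: (C1_continuous (C1_Gk k)).
have cpsi k : continuous (@psi R n k).
  by apply: continuous_rV => j; exact: C1_continuous (C1_psi k j).
have meta : measurable_fun setT (@eta R n m) by exact: continuous_measurable_rV.
have mD : measurable_fun setT D by exact: continuous_measurable_rV.
have := @bounded_cvg R n F
  (fun x => eta m x * (n%:R * G x) + D x * G x) (Ce * (n%:R * CK + Cf) + Cd * CK).
have -> : (fun k => \int[mu]_(x in B) F k x) = cst 0 by apply/funext => k; exact: F0.
move=> H; apply/esym; apply: (@cvg_unique R^o _ (cst (0 : R) @ \oo)); last first.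
- apply: H => [k||k x Bx|x Bx].
  + apply: measurable_funD; apply: measurable_funM => //.
    * apply: measurable_funD; apply: measurable_funM => //.
        exact: continuous_measurable_rV.
      - apply: measurable_funM => //; apply: measurable_funX.
        by apply: continuous_measurable_rV; exact: C1_continuous (C1_cinv k).
      - apply: continuous_measurable_rV => x.
        exact: (continuous_comp (@cpsi k x) (@cflow (psi k x))).
    * exact: continuous_measurable_rV.
  + apply: measurable_funD; apply: measurable_funM => //.
    exact: measurable_funM.
  + have bpsi := unit_ball_box (psi_ball k x); have bx := unit_ball_box Bx.
    have epsc : `|eps k * cinv k x ^+ 2| <= 1 :> R.
      rewrite ger0_norm; last by rewrite mulr_ge0 ?sqr_ge0// ltW// eps_gt0.
      rewrite -(cinv_sqr k x) mulrC ler_wpM2l ?sqr_ge0//.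
      by rewrite lerDr sqnorm_ge0.
    apply: ler_norm_add; apply: ler_norm_mul; [exact: He| |exact: Hd|exact: HK].
    apply: ler_norm_add; first by apply: ler_norm_mul; [rewrite normr_nat|exact: HK].
    by rewrite -[leRHS]mul1r; apply: ler_norm_mul epsc _; exact: Hf.
  + apply: cvgD.
      apply: cvgM; first exact: cvg_cst.
      rewrite -[X in _ --> X]addr0; apply: cvgD (flow_cvg x).
      by apply: cvgM; [exact: cvg_cst|exact: Gk_cvg].
    by apply: cvgM; [exact: cvg_cst|exact: Gk_cvg].
- exact: cvg_cst.
- exact: Rhausdorff.
Qed.

(* The cutoffs have a gradient of order m concentrated near the sphere, where this
   factor [1 - sqnorm x] compensates it: [m s^m (1 - s)] is bounded. *)
Let radial_lipschitz : exists2 C : R, 0 <= C &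
  forall x, B x -> `|K x - sqnorm x * G x| <= C * (1 - sqnorm x).
Proof.
have [CK CK0 HK] := box_bounded 1 cK.
pose w x := \sum_j `|dK j x|.
have cw : continuous w.
  apply: continuous_bigsum => j _ x.
  exact: (continuous_comp (@cdK j x) (@norm_continuous _ _ _)).
(* [MVT_line] bounds only the absolute value of [c], so the intermediate point [th + c *: th] is
   located in the box of radius 2. *)
have [L L0 HL] := box_bounded 2 cw.
exists (L + CK) => [|x Bx]; first exact: addr_ge0.
have [->|x0] := eqVneq x 0.
  have -> : sqnorm (0 : 'rV[R]_n) = 0 by apply/eqP; rewrite sqnorm_eq0.
  by rewrite K0 mul0r subrr normr0 subr0 mulr1 addr_ge0.
have e0 : 0 < enorm x by rewrite enorm_gt0.
have e1 : enorm x <= 1 by [].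
pose th := unit_normal x.
have xE : x = enorm x *: th by rewrite scalerA divff ?scale1r// gt_eqF.
have Bth : B th by exact: unit_normal_ball.
have dKth y : derivable K y th.
  by apply: diff_derivable; have [] := C1_diff y C1_K.
have [c c1 E] := @MVT_line R _ K th th (enorm x - 1) (fun s => dKth _).
have xth : th + (enorm x - 1) *: th = x.
  by rewrite scalerBl scale1r addrCA subrr addr0 -xE.
rewrite xth in E.
have DL : `|'D_th K (th + c *: th)| <= L.
  have [dd dE] := C1_diff (th + c *: th) C1_K.
  rewrite deriveE// dE; apply: le_trans (ler_norm_sum _ _ _) _.
  apply: le_trans (_ : w (th + c *: th) <= _).
    apply: ler_sum => j _; rewrite normrM ler_piMr//.
    exact: (unit_ball_box Bth j).
  apply: le_trans (ler_norm _) (HL _ _) => j.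
  rewrite [(th + _) 0 j]mxE [(c *: th) 0 j]mxE.
  have thj := unit_ball_box Bth j.
  have -> : 2 = 1 + 1 :> R by rewrite -natr1.
  apply: ler_norm_add => //; rewrite -[leRHS]mulr1; apply: ler_norm_mul => //.
  by apply: le_trans c1 _; rewrite ler0_norm ?subr_le0// opprB lerBlDr lerDl ltW.
have s1 : sqnorm x <= 1 by apply/unit_ballE.
have -> : K x - sqnorm x * G x = (K x - K th) + (1 - sqnorm x) * K th.
  by rewrite /G -/th; ring.
rewrite [leRHS]mulrDl; apply: ler_norm_add; last first.
  rewrite mulrC; apply: ler_norm_mul; first exact/HK/unit_ball_box.
  by rewrite ger0_norm// subr_ge0.
rewrite E mulrC; apply: ler_norm_mul => //.
rewrite ler0_norm ?subr_le0// opprB lerD2l lerN2 -enorm_sqr expr2.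
by rewrite ler_piMr// ltW.
Qed.

(* Both [V] and the field [x K(x/|x|)], of divergence [n K(x/|x|)], are tested
   against the cutoffs [eta m]; the gradient terms of the two identities cancel as
   [m] tends to infinity. *)
Lemma divergence_unit_ball :
  \int[mu]_(x in B) (\sum_i dV i i x) =
  n%:R * \int[mu]_(x in B) \sum_k V k (unit_normal x) * unit_normal x 0 k.
Proof.
rewrite -/divV.
have mB : measurable B by exact: measurable_unit_ball.
have [C C0 HC] := radial_lipschitz.
have cdiv : continuous divV.
  by apply: continuous_bigsum => i _; have [] := hV i i.
have [CK CK0 HK] := box_bounded 1 cK.
have [Cd Cd0 Hd] := box_bounded 1 cdiv.
have BMG : BM G by split => //; exists CK => // x _; exact/HK/unit_ball_box.
have BMdiv : BM divV by exact: BM_continuous.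
pose D m x := \sum_i V i x * deta m i x.
pose E m x := \sum_i x 0 i * deta m i x.
have BMD m : BM (D m).
  apply: BM_sum => i; apply: BM_M; apply: BM_continuous.
    exact: C1_continuous (hV i).
  by have [] := @C1_eta R n m i.
have BME m : BM (E m).
  apply: BM_sum => i; apply: BM_M; apply: BM_continuous.
    exact: continuous_coord.
  by have [] := @C1_eta R n m i.
have BMeta m : BM (@eta R n m) by apply: BM_continuous; exact: (C1_continuous (@C1_eta R n m)).
pose F m x := eta m x * divV x + D m x - (eta m x * (n%:R * G x) + E m x * G x).
have BMnG : BM (fun x => n%:R * G x) by apply: BM_M BMG; exact: BM_cst.
have BMF1 m : BM (fun x => eta m x * divV x + D m x) by apply: BM_D => //; exact: BM_M.
have BMF2 m : BM (fun x => eta m x * (n%:R * G x) + E m x * G x).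
  by apply: BM_D; apply: BM_M.
have BMF m : BM (F m) by exact: BM_B.
have F0 m : \int[mu]_(x in B) F m x = 0.
  rewrite RintegralB//; try exact: BM_integrable.
  by rewrite cutoff_divergence// radial_identity subrr.
pose p m x := pos (1 - sqnorm x ^+ m.+1) : R.
(* The gradient of [eta m] is a multiple of [x], so the gradient terms of the two identities combine
   into one multiple of the difference estimated by [radial_lipschitz]. *)
have FE m x : F m x = eta m x * (divV x - n%:R * G x)
    - 4 * p m x * (m.+1%:R * sqnorm x ^+ m) * (K x - sqnorm x * G x).
  have DD : D m x = - (4 * p m x * (m.+1%:R * sqnorm x ^+ m)) * K x.
    by rewrite /D mulr_sumr; apply: eq_bigr => i _; rewrite /deta -/(p m x); ring.
  have EE : E m x = - (4 * p m x * (m.+1%:R * sqnorm x ^+ m)) * sqnorm x.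
    by rewrite /E mulr_sumr; apply: eq_bigr => i _; rewrite /deta -/(p m x); ring.
  by rewrite /F DD EE; ring.
have p01 m x : B x -> `|p m x| <= 1.
  move=> Bx; rewrite /p eta_in//; have /unit_ballE s1 := Bx.
  by rewrite ger0_norm ?gerBl ?subr_ge0 ?exprn_ile1 ?exprn_ge0 ?sqnorm_ge0.
have eta01 m x : B x -> `|eta m x| <= 1.
  move=> Bx; rewrite -[leRHS]mulr1 /eta -eta_in//.
  by apply: ler_norm_mul; rewrite ?eta_in//; have := p01 m x Bx; rewrite /p eta_in.
have H := @bounded_cvg R n F (fun x => (sqnorm x < 1)%R%:R * (divV x - n%:R * G x))
  (1 * (Cd + n%:R * CK) + 4 * 1 * C).
have : 0 = \int[mu]_(x in B) ((sqnorm x < 1)%R%:R * (divV x - n%:R * G x)).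
  have F00 : (fun m => \int[mu]_(x in B) F m x) = cst 0 by apply/funext => m; exact: F0.
  apply: (@cvg_unique R^o _ (cst (0 : R) @ \oo)); last first.
  - rewrite -F00; apply: H => [m||m x Bx|x Bx].
    + by have [] := BMF m.
    + apply: measurable_funM; last by have [] := BM_B BMdiv BMnG.
      rewrite (_ : (fun x : 'rV[R]_n => (sqnorm x < 1)%R%:R) = \1_(@open_unit_ball R n)).
        by apply: measurable_indic; exact: (@measurable_open_unit_ball R n).
      by apply/funext => x; exact: indic_open_unit_ball.
    + have /unit_ballE s1 := Bx.
      rewrite FE; apply: ler_norm_add.
        apply: ler_norm_mul; first exact: eta01.
        apply: ler_norm_add; first exact/Hd/unit_ball_box.
        by rewrite normrN; apply: ler_norm_mul; [rewrite normr_nat|exact/HK/unit_ball_box].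
      rewrite normrN -mulrA; apply: ler_norm_mul.
        by apply: ler_norm_mul; [rewrite normr_nat|exact: p01].
      have m0 : 0 <= m.+1%:R * sqnorm x ^+ m by rewrite mulr_ge0// exprn_ge0// sqnorm_ge0.
      rewrite normrM (ger0_norm m0); apply: le_trans (ler_wpM2l m0 (HC x Bx)) _.
      rewrite mulrCA ler_piMr//; apply: natmul_expr_le1.
      by rewrite sqnorm_ge0.
    (* On the sphere itself [eta m x] and [p m x] are 0; inside, they tend to 1 and the gradient
       factor tends to 0. *)
    + have /unit_ballE := Bx; rewrite le_eqVlt => /predU1P[s1|s1].
        rewrite s1 ltxx mul0r; rewrite (_ : (fun m => _) = cst 0); first exact: cvg_cst.
        apply/funext => m; rewrite FE /p /eta s1 expr1n subrr /pos maxxx.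
        by rewrite !(mulr0, mul0r) subrr.
      have s0 : 0 <= sqnorm x by exact: sqnorm_ge0.
      have cp : p m x @[m --> \oo] --> (1 : R).
        rewrite (_ : (fun m => _) = (fun m => 1 - sqnorm x ^+ m.+1)); last first.
          by apply/funext => m; rewrite /p eta_in.
        rewrite -[X in _ --> X]subr0; apply: cvgB; first exact: cvg_cst.
        have : sqnorm x ^+ m @[m --> \oo] --> (0 : R) by apply: cvg_expr; rewrite ger0_norm.
        by rewrite -(cvg_shiftS (fun m => sqnorm x ^+ m)).
      rewrite s1 mul1r.
      rewrite (_ : (fun m => _) = (fun m => p m x * p m x * (divV x - n%:R * G x)
        - 4 * p m x * (m.+1%:R * sqnorm x ^+ m) * (K x - sqnorm x * G x))); last first.
        apply/funext => m; rewrite FE; congr (_ * _ - _).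
        by rewrite /p /eta eta_in.
      rewrite -[X in _ --> X]subr0; apply: cvgB.
        have pp := cvgM cp cp; rewrite mulr1 in pp.
        by rewrite -[X in _ --> X]mul1r; apply: cvgM; [exact: pp|exact: cvg_cst].
      rewrite -[X in _ --> X](mul0r (K x - sqnorm x * G x)).
      apply: cvgM; last exact: cvg_cst.
      rewrite -[X in _ --> X](mulr0 (4 * 1)); apply: cvgM.
        by apply: cvgM; first exact: cvg_cst.
      by apply: cvg_natmul_expr; rewrite s0.
  - exact: cvg_cst.
  - exact: Rhausdorff.
rewrite Rintegral_open_unit_ball; last by have [] := BM_B BMdiv BMnG.
rewrite RintegralB//; try exact: BM_integrable.
rewrite RintegralZl//; last exact: BM_integrable.
by move/esym/eqP; rewrite subr_eq0 => /eqP.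
Qed.

End divergence_unit_ball.

(** * Fluxes through spheres of large radius *)

Section sphere_integrals.
Context {R : realType} {n : nat}.
Implicit Types (x : 'rV[R]_n) (V W : 'I_n -> 'rV[R]_n -> R).
Local Notation mu := (lebesgue_Rn n : {measure set 'rV[R]_n -> \bar R}).
Local Notation B := (@unit_ball R n).

Lemma ge0_integral_sphere (F : 'rV[R]_n -> \bar R) : measurable_fun setT F ->
  (forall x, (0 <= F x)%E) ->
  (\int[sphere_measure n]_x F x = n%:R%:E * \int[mu]_(x in B) F (unit_normal x))%E.
Proof.
move=> mF F0.
have mB : measurable B by exact: measurable_unit_ball.
have mFn : measurable_fun setT (fun x => F (unit_normal x)).
  exact: (measurableT_comp mF (@measurable_unit_normal R n)).
rewrite /sphere_measure ge0_integral_mscale//; congr (_ * _)%E.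
pose nu : {measure set 'rV[R]_n -> \bar R} := mrestr mu mB.
have := @ge0_integral_pushforward _ _ 'rV[R]_n 'rV[R]_n R (@unit_normal R n)
  (@measurable_unit_normal R n) nu setT F measurableT mF (fun x _ => F0 x).
rewrite preimage_setT => E; rewrite [LHS]E.
rewrite (@ge0_negligible_integral _ _ _ nu setT (~` B))//; last 3 first.
- exact: measurableC.
- by move=> x _; exact: F0.
- by rewrite /nu /= /mrestr setICl measure0.
rewrite setTD setCK.
apply: eq_measure_integral => A mA AB; rewrite /nu /= /mrestr.
by rewrite (setIidl AB).
Qed.

Lemma Rintegral_sphere (u : 'rV[R]_n -> R) : measurable_fun setT u ->
  BM (u \o @unit_normal R n) ->
  \int[sphere_measure n]_x u x = n%:R * \int[mu]_(x in B) u (unit_normal x).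
Proof.
move=> mu' bu; apply: Rintegral_transfer => //.
- exact: measurable_unit_ball.
- exact: ge0_integral_sphere.
- exact: BM_integrable.
Qed.

Lemma enorm_unit_normal x : x != 0 -> enorm (unit_normal x) = 1.
Proof.
by move=> x0; rewrite enormZ ?invr_ge0 ?enorm_ge0// mulVf// enorm_eq0.
Qed.

Lemma unit_normalZ (r : R) x : 0 < r -> unit_normal (r *: x) = unit_normal x.
Proof.
move=> r0; rewrite /unit_normal enormZ ?ltW// scalerA invfM mulrAC mulVf ?mul1r//.
by rewrite gt_eqF.
Qed.

Lemma unit_normal_id x : unit_normal (unit_normal x) = unit_normal x.
Proof.
have [->|x0] := eqVneq x 0; first by rewrite /unit_normal !scaler0.
by rewrite {2}/unit_normal unit_normalZ// invr_gt0 enorm_gt0.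
Qed.

Lemma unit_normal_ball x : B (unit_normal x).
Proof.
have [->|x0] := eqVneq x 0; last by rewrite /unit_ball /= enorm_unit_normal.
by rewrite /unit_normal scaler0; apply/unit_ballE; rewrite /sqnorm big1// => i _;
  rewrite mxE expr0n.
Qed.

Definition radial V (r : R) x : R :=
  \sum_i V i (r *: unit_normal x) * unit_normal x 0 i.

Lemma continuous_scale (r : R) : continuous (fun x : 'rV[R]_n => r *: x).
Proof. by move=> x; exact: (@scaler_continuous _ _ r x). Qed.

Lemma BM_radial V r : (forall i, continuous (V i)) -> BM (radial V r).
Proof.
move=> cV; apply: BM_sum => i; apply: BM_M.
  have c : continuous (fun x => V i (r *: x)).
    by move=> x; exact: (continuous_comp (@continuous_scale r x) (cV i _)).
  have [C C0 HC] := box_bounded 1 c; split.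
    exact: (measurableT_comp (continuous_measurable_rV c) (@measurable_unit_normal R n)).
  by exists C => // x _; apply: HC; apply: unit_ball_box; exact: unit_normal_ball.
split; first exact: (measurableT_comp (measurable_coord i) (@measurable_unit_normal R n)).
by exists 1 => // x _; apply: (unit_ball_box (unit_normal_ball x)).
Qed.

Lemma sphere_fluxE V (r : R) : 0 < r -> (forall i, continuous (V i)) ->
  sphere_flux V r = r ^+ n.-1 * (n%:R * \int[mu]_(x in B) radial V r x).
Proof.
move=> r0 cV; rewrite /sphere_flux /sphere_integral; congr (_ * _).
have E x : \sum_i V i (r *: unit_normal x) * unit_normal (r *: unit_normal x) 0 i =
    radial V r x.
  by apply: eq_bigr => i _; rewrite unit_normalZ// unit_normal_id.
rewrite Rintegral_sphere.
- by congr (_ * _); apply: eq_Rintegral => x _; exact: E.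
- apply: measurable_sum => i; apply: measurable_funM.
    apply: continuous_measurable_rV => x.
    exact: (continuous_comp (@continuous_scale r x) (cV i _)).
  apply: (measurableT_comp (measurable_coord i)).
  apply: (measurableT_comp (@measurable_unit_normal R n)).
  apply: measurable_fun_coordP => j.
  under eq_fun do rewrite mxE.
  by apply: measurable_funM; [exact: measurable_cst|exact: measurable_coord].
- rewrite (_ : _ \o _ = radial V r); first exact: BM_radial.
  by apply/funext => x; exact: E.
Qed.

Lemma sphere_fluxD V W (r : R) : 0 < r -> (forall i, continuous (V i)) ->
  (forall i, continuous (W i)) ->
  sphere_flux (fun i x => V i x + W i x) r = sphere_flux V r + sphere_flux W r.
Proof.
move=> r0 cV cW; rewrite !sphere_fluxE// => [|i x]; last exact: (continuousD (cV i x) (cW i x)).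
rewrite -!mulrDr -RintegralD.
- congr (_ * (_ * _)); apply: eq_Rintegral => x _.
  by rewrite /radial -big_split; apply: eq_bigr => i _; rewrite mulrDl.
- exact: measurable_unit_ball.
- exact/BM_integrable/BM_radial.
- exact/BM_integrable/BM_radial.
Qed.

Lemma measurable_eball (r : R) : measurable [set x : 'rV[R]_n | enorm x <= r].
Proof.
rewrite [X in measurable X](_ : _ = setT `&` @enorm R n @^-1` `]-oo, r]%classic).
  exact: (@measurable_enorm R n).
by rewrite setTI; apply/seteqP; split => x /=; rewrite in_itv.
Qed.

(** The case of the unit ball for the field [V (r *: x)]: its derivatives carry a factor [r], which
    together with [r ^+ n.-1] from the area element gives the Jacobian [r ^+ n] of the dilation. *)
Lemma divergence_theorem V (dV : 'I_n -> 'I_n -> 'rV[R]_n -> R) (r : R) :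
  (0 < n)%N -> 0 < r -> (forall i, C1 (V i) (dV i)) ->
  sphere_flux V r = \int[mu]_(x in [set x | enorm x <= r]) (\sum_i dV i i x).
Proof.
move=> n0 r0 hV.
have cV i : continuous (V i) by exact: C1_continuous (hV i).
have cd : continuous (fun x => \sum_i dV i i x).
  by apply: continuous_bigsum => i _; have [] := hV i i.
pose Vr i x := V i (r *: x).
have hVr i : C1 (Vr i) (fun j x => r * dV i j (r *: x)).
  have hs k : C1 (fun x => (r *: x) 0 k) (fun j x => r * (j == k)%:R).
    apply: C1_eq (C1M (C1_cst r) (C1_coord k)) _ _ => [x|j x]; first by rewrite mxE.
    by rewrite mulr0 addr0.
  apply: C1_eq (C1_comp hs (hV i)) _ _ => // j x.
  by under eq_bigr do rewrite mulrA; rewrite sum_delta mulrC.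
rewrite sphere_fluxE//.
have -> : n%:R * \int[mu]_(x in B) radial V r x =
    \int[mu]_(x in B) (r * \sum_i dV i i (r *: x)).
  rewrite -[LHS](divergence_unit_ball hVr); apply: eq_Rintegral => x _.
  by rewrite mulr_sumr.
have cdr : continuous (fun x => \sum_i dV i i (r *: x)).
  by move=> x; exact: (continuous_comp (@continuous_scale r x) (cd _)).
have mB : measurable B by exact: measurable_unit_ball.
have iB := BM_integrable (BM_continuous cdr).
rewrite RintegralZl// mulrA -exprSr prednK//.
pose A : set 'rV[R]_n := [set x | enorm x <= r].
have mA : measurable A by exact: measurable_eball.
rewrite Rintegral_mkcond [RHS]Rintegral_mkcond.
have E : (fun x => \sum_i dV i i (r *: x)) \_ B =
    ((fun x => \sum_i dV i i x) \_ A) \o (fun x => r *: x).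
  apply/funext => x; rewrite /= !patchE; congr (if _ then _ else _).
  apply/idP/idP; rewrite !inE /A /= (enormZ _ (ltW r0)).
    by move=> xB; rewrite -[leRHS]mulr1 ler_wpM2l// ltW.
  by rewrite -ler_pdivlMl// mulVf ?gt_eqF.
rewrite E; apply/esym/(@Rintegral_transfer _ _ _ _ R mu mu setT (fun x => r *: x)).
- exact: measurableT.
- by move=> F mF F0; exact: ge0_integral_scale.
- exact: ((measurable_restrictT _ mA).1 (measurable_funTS (continuous_measurable_rV cd))).
- rewrite -E; have := (integrable_mkcond _ mB).1 iB.
  by rewrite restrict_EFin.
Qed.

Lemma divergence_theorem_infty V (dV : 'I_n -> 'I_n -> 'rV[R]_n -> R) :
  (0 < n)%N -> (forall i, C1 (V i) (dV i)) ->
  mu.-integrable setT (EFin \o (fun x => \sum_i dV i i x)) ->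
  sphere_flux V r @[r --> +oo] --> \int[mu]_x (\sum_i dV i i x).
Proof.
move=> n0 hV iL; set L := (fun x => \sum_i dV i i x) in iL *.
have mL : measurable_fun setT L by apply/measurable_EFinP; exact: measurable_int iL.
pose h r := \int[mu]_(x in [set x | enorm x <= r]) L x.
apply: (@cvg_trans _ (h r @[r --> +oo])).
  apply: near_eq_cvg; near=> r.
  have r0 : 0 < r by near: r; exact: nbhs_pinfty_gt.
  by rewrite (divergence_theorem n0 r0 hV).
apply/cvg_pinftyP => u cu.
pose A m : set 'rV[R]_n := [set x | enorm x <= u m].
have mA m : measurable (A m) by exact: measurable_eball.
have [|||||iu _ H] := @dominated_convergence _ _ R mu setT measurableT
  (fun m => EFin \o (L \_ (A m))) (EFin \o L) (fun x => `|L x|%:E).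
- move=> m; apply/measurable_EFinP; exact: ((measurable_restrictT _ (mA m)).1 (measurable_funTS mL)).
- exact/measurable_EFinP.
- apply: aeW => x _; apply: cvg_EFin; first exact: nearW.
  apply: cvg_near_cst; near=> m; rewrite /= patchE mem_set// /A /=.
  by near: m; have /cvgryPge := cu; apply.
- exact: integrable_abse iL.
- apply: aeW => x m _; rewrite lee_fin patchE.
  by case: ifP => // _; rewrite normr0.
have fi := integrable_fin_num measurableT iL.
rewrite -(fineK fi) in H; have H' := fine_cvg H.
rewrite (_ : (fun m => h (u m)) = fine \o [sequence
  (\int[mu]_x (EFin \o L \_ (A m)) x)%E]_m); first exact: H'.
by apply/funext => m /=; rewrite /h Rintegral_mkcond.
Unshelve. all: by end_near. Qed.

Lemma powR_cvg_pinfty (q : R) : 0 < q -> r `^ (- q) @[r --> +oo] --> 0.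
Proof.
move=> q0; apply/cvgrPdist_le => e e0; near=> r.
have r0 : 0 < r by near: r; exact: nbhs_pinfty_gt.
have re : expR (- (ln e / q)) < r by near: r; exact: nbhs_pinfty_gt.
rewrite sub0r normrN ger0_norm ?powR_ge0//.
rewrite -[leRHS]lnK// -ler_ln ?posrE ?powR_gt0 ?expR_gt0// expRK ln_powR.
rewrite mulNr lerNl mulrC -ler_pdivrMr// mulNr.
by rewrite -[leLHS]expRK ler_ln ?posrE ?expR_gt0// ltW.
Unshelve. all: by end_near. Qed.

Lemma sphere_flux_decay V (p : R) : (0 < n)%N -> (forall i, continuous (V i)) ->
  (forall i, bigO_infty (V i) (- p)) -> n%:R - 1 < p ->
  sphere_flux V r @[r --> +oo] --> 0.
Proof.
move=> n0 cV OV np.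
have [C [M [C0 HC]]] : exists C M : R, 0 <= C /\
    forall i x, M < enorm x -> `|V i x| <= C * enorm x `^ (- p).
  have /choice[c hc] := OV; have /choice[m hm] := hc.
  exists (\sum_i `|c i|), (\big[Num.max/0]_i m i); split; first exact: sumr_ge0.
  move=> i x Mx; apply: le_trans (hm i x _) _.
    by apply: le_lt_trans Mx; exact: le_bigmax.
  rewrite ler_wpM2r ?powR_ge0// (le_trans (ler_norm _))//.
  by rewrite (bigD1 i)//= lerDl sumr_ge0.
(* One factor [n] comes from the area measure, the other from bounding the [n] terms of the normal
   component separately. *)
pose K := n%:R * (n%:R * C * fine (mu B)).
have H : K * r `^ (- (p - (n%:R - 1))) @[r --> +oo] --> 0.
  rewrite -[X in _ --> X](mulr0 K); apply: cvgM; first exact: cvg_cst.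
  by apply: powR_cvg_pinfty; rewrite subr_gt0.
apply/norm_cvg0P; apply: squeeze_cvgr (cvg_cst 0) H.
near=> r.
have r0 : 0 < r by near: r; exact: nbhs_pinfty_gt.
have Mr : M < r by near: r; apply: nbhs_pinfty_gt; exact: num_real.
rewrite normr_ge0 /= sphere_fluxE//.
have -> : K * r `^ (- (p - (n%:R - 1))) =
    r ^+ n.-1 * (n%:R * (n%:R * C * r `^ (- p) * fine (mu B))).
  rewrite opprB addrC powRD; last by apply/implyP => _; rewrite gt_eqF.
  rewrite -[n%:R - 1](_ : n.-1%:R = _); last by rewrite -subn1 natrB.
  by rewrite powR_mulrn ?ltW// /K; ring.
have rn : 0 <= r ^+ n.-1 by rewrite exprn_ge0 ?ltW.
rewrite normrM (ger0_norm rn); apply: ler_wpM2l => //.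
rewrite normrM normr_nat; apply: ler_wpM2l => //.
have mB : measurable B by exact: measurable_unit_ball.
have bV := BM_radial r cV.
apply: le_trans (le_normr_Rintegral mB (BM_integrable bV)) _.
rewrite -Rintegral_cst//; apply: le_Rintegral => //.
- by apply: BM_integrable; case: bV => m [D D0 HD]; split;
    [exact: measurableT_comp|exists D => // x /HD; rewrite normr_id].
- exact: (BM_integrable (BM_cst _)).
(* [unit_normal 0] is 0, so only for [x != 0] does [r *: unit_normal x] have norm [r], where the
   decay applies. *)
move=> x Bx; have [->|x0] := eqVneq x 0.
  rewrite /radial big1 ?normr0 => [|i _]; last by rewrite /unit_normal scaler0 mxE mulr0.
  by rewrite !mulr_ge0 ?powR_ge0.
rewrite /radial -mulrA mulr_natl.
apply: le_trans (ler_norm_sum _ _ _) _.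
rewrite -[X in _ *+ X](card_ord n) -sumr_const; apply: ler_sum => i _.
rewrite -[leRHS]mulr1; apply: ler_norm_mul; last exact: (unit_ball_box (unit_normal_ball x)).
have er : enorm (r *: unit_normal x) = r by rewrite enormZ ?ltW// enorm_unit_normal// mulr1.
by rewrite -[r in leRHS]er; apply: HC; rewrite er.
Unshelve. all: by end_near. Qed.

End sphere_integrals.

(** * Newton tensors *)

Section trace_algebra.
Context {R : realType} {n : nat}.
Implicit Types A B M X Y : 'M[R]_n.

Lemma sum_entries_trace A B : \sum_i \sum_k A i k * B i k = \tr (A *m B^T).
Proof.
rewrite /mxtrace; apply: eq_bigr => i _; rewrite mxE.
by apply: eq_bigr => k _; rewrite mxE.
Qed.

Lemma mxtraceN A : \tr (- A) = - \tr A.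
Proof. exact: raddfN. Qed.

Lemma mxtrace_scalar_mul (a : R) A : \tr (a%:M *m A) = a * \tr A.
Proof. by rewrite mul_scalar_mx mxtraceZ. Qed.

(* Newton's tensors: for [k > 0], [sigma k H] is k! times the k-th elementary symmetric
   function of the eigenvalues of [H] (while [sigma 0 H = sigma 1 H]), and
   [k.+1%:R *: newton k H] is the gradient of [sigma k.+1] at [H]. *)
Fixpoint newton (k : nat) (H : 'M[R]_n) : 'M[R]_n :=
  if k is k'.+1 then (\tr (newton k' H *m H))%:M - k%:R *: (newton k' H *m H)
  else 1%:M.

Definition sigma (k : nat) (H : 'M[R]_n) : R := \tr (newton k.-1 H *m H).

Lemma newton1 H : newton 1 H = (\tr H)%:M - H.
Proof. by rewrite /= mul1mx scale1r. Qed.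

Lemma sigma2 H : sigma 2 H = \tr H ^+ 2 - \tr (H *m H).
Proof. by rewrite /sigma newton1 mulmxBl raddfB /= mxtrace_scalar_mul expr2. Qed.

Lemma newton2 H : newton 2 H = (sigma 2 H)%:M - (2 * \tr H) *: H + 2 *: (H *m H).
Proof.
rewrite -/(sigma 2 H) [newton 2 H]/= -/(newton 1 H) newton1.
rewrite mulmxBl mul_scalar_mx scalerBr scalerA opprB addrA addrAC; congr (_ - _ + _).
by rewrite /sigma newton1 mulmxBl mul_scalar_mx.
Qed.

Lemma sigma3 H : sigma 3 H =
  \tr H ^+ 3 - 3 * \tr H * \tr (H *m H) + 2 * \tr (H *m H *m H).
Proof.
rewrite /sigma newton2 mulmxDl mulmxBl !raddfD /= raddfN /= -!scalemxAl !mxtraceZ.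
by rewrite mxtrace_scalar_mul sigma2; ring.
Qed.

Lemma newton3 H : newton 3 H = (sigma 3 H)%:M - (3 * sigma 2 H) *: H
  + (6 * \tr H) *: (H *m H) - 6 *: (H *m H *m H).
Proof.
rewrite [newton 3 H]/= -/(newton 2 H) -/(sigma 3 H) newton2.
rewrite mulmxDl mulmxBl mul_scalar_mx -!scalemxAl !scalerDr scalerN !scalerA.
rewrite !opprD opprK !addrA; congr (_ - _ *: _ + _ *: _ - _ *: _); ring.
Qed.

Lemma sigma4 H : sigma 4 H =
  \tr H ^+ 4 - 6 * \tr H ^+ 2 * \tr (H *m H) + 3 * \tr (H *m H) ^+ 2
  + 8 * \tr H * \tr (H *m H *m H) - 6 * \tr (H *m H *m H *m H).
Proof.
rewrite /sigma newton3 mulmxBl mulmxDl mulmxBl !(raddfD, raddfN) /= -!scalemxAl !mxtraceZ.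
by rewrite mxtrace_scalar_mul sigma3 sigma2; ring.
Qed.

Section rank_one_update.
Variables (H : 'M[R]_n) (u : 'cV[R]_n) (v : 'rV[R]_n).
Let A := H - u *m v.
(** The moments [v H^k u]. Cyclicity of the trace opens each factor [u v] in a power of [A], so
    traces of powers of [A] differ from those of [H] by polynomials in these moments. *)
Let a (k : nat) : R := (v *m iter k (mulmx H) u) 0 0.

Let mulA_u (w : 'cV[R]_n) : A *m w = H *m w - (v *m w) 0 0 *: u.
Proof.
rewrite mulmxBl; congr (_ - _); rewrite -mulmxA [v *m w]mx11_scalar.
by rewrite mul_mx_scalar [(_%:M) 0 0]mxE eqxx mulr1n.
Qed.

Let c1 : A *m u = H *m u - a 0 *: u.
Proof. exact: mulA_u. Qed.

Let v_lin (X : 'cV[R]_n) (k : R) (Y : 'cV[R]_n) :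
  (v *m (X - k *: Y)) 0 0 = (v *m X) 0 0 - k * (v *m Y) 0 0.
Proof.
by rewrite mulmxBr -scalemxAr; move: (v *m X) (v *m Y) => P Q; rewrite !mxE.
Qed.

Let c2 : A *m (A *m u) = H *m (H *m u) - a 0 *: (H *m u) - (a 1 - a 0 ^+ 2) *: u.
Proof.
rewrite mulA_u c1 v_lin mulmxBr -scalemxAr; congr (_ - _ - _ *: _).
Qed.

Let c3 : A *m (A *m (A *m u)) = H *m (H *m (H *m u)) - a 0 *: (H *m (H *m u))
  - (a 1 - a 0 ^+ 2) *: (H *m u) - (a 2 - 2 * a 0 * a 1 + a 0 ^+ 3) *: u.
Proof.
rewrite mulA_u c2 !v_lin !mulmxBr -!scalemxAr; congr (_ - _ - _ - _ *: _).
by rewrite /a /=; ring.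
Qed.

Let tr_step X Y : \tr (X *m A *m Y) = \tr (X *m (H *m Y)) - (v *m (Y *m (X *m u))) 0 0.
Proof.
rewrite mulmxBr mulmxBl raddfB /= !mulmxA; congr (_ - _).
by rewrite -!mulmxA mxtrace_mulC -!mulmxA mxtrace_mulC -!mulmxA trace_mx11.
Qed.

Lemma trace_update1 : \tr A = \tr H - a 0.
Proof. by have := tr_step 1%:M 1%:M; rewrite !(mul1mx, mulmx1). Qed.

Lemma trace_update2 : \tr (A *m A) = \tr (H *m H) - 2 * a 1 + a 0 ^+ 2.
Proof.
have := tr_step A 1%:M; rewrite !(mul1mx, mulmx1) => ->.
have := tr_step 1%:M H; rewrite !(mul1mx, mulmx1) => ->.
by rewrite c1 v_lin /a /=; ring.
Qed.

Lemma trace_update3 : \tr (A *m A *m A) =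
  \tr (H *m H *m H) - 3 * a 2 + 3 * a 0 * a 1 - a 0 ^+ 3.
Proof.
have := tr_step (A *m A) 1%:M; rewrite !(mul1mx, mulmx1) => ->.
rewrite (tr_step A H).
have := tr_step 1%:M (H *m H); rewrite !(mul1mx, mulmx1) => ->.
rewrite -!mulmxA c2 c1 !v_lin mulmxBr -scalemxAr v_lin /a /=; ring.
Qed.

Lemma trace_update4 : \tr (A *m A *m A *m A) = \tr (H *m H *m H *m H)
  - 4 * a 3 + 4 * a 0 * a 2 + 2 * a 1 ^+ 2 - 4 * a 0 ^+ 2 * a 1 + a 0 ^+ 4.
Proof.
have := tr_step (A *m A *m A) 1%:M; rewrite !(mul1mx, mulmx1) => ->.
rewrite (tr_step (A *m A) H).
rewrite (tr_step A (H *m H)).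
have := tr_step 1%:M (H *m (H *m H)); rewrite !(mul1mx, mulmx1) => ->.
rewrite -!mulmxA c3 c2 c1 !(mulmxBr, =^~ scalemxAr).
rewrite /a /=; move: (v *m u) (v *m (H *m u)) (v *m (H *m (H *m u)))
  (v *m (H *m (H *m (H *m u)))) => P0 P1 P2 P3; rewrite !mxE; ring.
Qed.

Let v_newton1 : (v *m newton 1 H *m u) 0 0 = \tr H * a 0 - a 1.
Proof.
rewrite newton1 -mulmxA mulmxBl mul_scalar_mx mulmxBr -scalemxAr /a /=.
by move: (v *m u) (v *m (H *m u)) => P Q; rewrite !mxE.
Qed.

(** For [k > 0], [sigma k] is a multiple of the sum of the principal minors of order [k], and minors
    are affine in a rank one term. Only the first order term survives, given by the gradient
    [k%:R *: newton k.-1]; the trace formulas check this for [k] equal to 2 and 4. *)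
Lemma sigma2_update : sigma 2 A = sigma 2 H - 2 * (v *m newton 1 H *m u) 0 0.
Proof. by rewrite !sigma2 v_newton1 trace_update1 trace_update2; ring. Qed.

Lemma sigma4_update : sigma 4 A = sigma 4 H - 4 * (v *m newton 3 H *m u) 0 0.
Proof.
have -> : (v *m newton 3 H *m u) 0 0 =
    sigma 3 H * a 0 - 3 * sigma 2 H * a 1 + 6 * \tr H * a 2 - 6 * a 3.
  rewrite newton3 -mulmxA !(mulmxBl, mulmxDl) mul_scalar_mx -!scalemxAl.
  rewrite !(mulmxBr, mulmxDr, mulmxN) -!scalemxAr -!mulmxA.
  rewrite /a /=; move: (v *m u) (v *m (H *m u)) (v *m (H *m (H *m u)))
    (v *m (H *m (H *m (H *m u)))) => P0 P1 P2 P3; rewrite !mxE; ring.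
rewrite !sigma4 sigma3 sigma2 trace_update1 trace_update2 trace_update3 trace_update4.
by ring.
Qed.

End rank_one_update.

End trace_algebra.

Section newton_divergence.
Context {R : realType} {n : nat}.
Implicit Types H T : 'M[R]_n.

(* The derivative of [newton k] at [H] in the direction [T]. *)
Fixpoint dnewton (k : nat) (H T : 'M[R]_n) : 'M[R]_n :=
  if k is k'.+1 then
    let D := dnewton k' H T *m H + newton k' H *m T in (\tr D)%:M - k%:R *: D
  else 0.

Definition dsigma (k : nat) H T : R :=
  \tr (dnewton k.-1 H T *m H + newton k.-1 H *m T).

Lemma dsigma1 H T : dsigma 1 H T = 1 * \tr (newton 0 H *m T).
Proof. by rewrite /dsigma /= mul0mx add0r mul1r. Qed.

Lemma dnewton1 H T : dnewton 1 H T = (\tr T)%:M - T.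
Proof. by rewrite /= mul0mx add0r mul1mx scale1r. Qed.

Lemma dsigma2 H T : dsigma 2 H T = 2 * \tr (newton 1 H *m T).
Proof.
rewrite /dsigma [2.-1]/= dnewton1 newton1 raddfD /= !mulmxBl !raddfB /=.
by rewrite !mxtrace_scalar_mul [\tr (T *m H)]mxtrace_mulC; ring.
Qed.

Lemma dnewton2 H T : dnewton 2 H T =
  (dsigma 2 H T)%:M - 2 *: (dnewton 1 H T *m H + newton 1 H *m T).
Proof. by []. Qed.

Lemma dsigma3 H T : dsigma 3 H T = 3 * \tr (newton 2 H *m T).
Proof.
rewrite /dsigma [3.-1]/= dnewton2 dsigma2 dnewton1 newton2 newton1 raddfD /=.
rewrite sigma2 !(mulmxDl, mulNmx, mul_scalar_mx, =^~ scalemxAl).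
rewrite !(mxtraceD, mxtraceN, mxtraceZ).
have -> : \tr (T *m H *m H) = \tr (H *m H *m T) by rewrite mxtrace_mulC mulmxA mxtrace_mulC !mulmxA mxtrace_mulC !mulmxA.
have -> : \tr (H *m T *m H) = \tr (H *m H *m T) by rewrite mxtrace_mulC !mulmxA.
rewrite [\tr (T *m H)]mxtrace_mulC; ring.
Qed.

(* Newton's tensors of a Hessian are divergence free: [T l] stands for the l-th
   partial derivative of [H], and the hypothesis on [T] for the symmetry of third
   derivatives. *)
Section divergence_free.
Variables (H : 'M[R]_n) (T : 'I_n -> 'M[R]_n).
Hypothesis T_sym : forall i j m, T j m i = T i m j.

(** The trace term of [newton k.+1] contributes [dsigma]. It cancels the contraction of [newton k]
    with the third derivatives, once their indices are exchanged; what remains contains the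
    divergence of [newton k]. *)
Let divfreeS k :
  (forall i, dsigma k.+1 H (T i) = k.+1%:R * \tr (newton k H *m T i)) ->
  (forall i, \sum_j dnewton k H (T j) j i = 0) ->
  forall i, \sum_j dnewton k.+1 H (T j) j i = 0.
Proof.
move=> ds df i.
have E j : dnewton k.+1 H (T j) j i = dsigma k.+1 H (T j) *+ (j == i) -
    k.+1%:R * (\sum_m dnewton k H (T j) j m * H m i + \sum_m newton k H j m * T j m i).
  by rewrite /= !mxE.
under eq_bigr do rewrite E.
rewrite sumrB (bigD1 i)//= eqxx mulr1n big1 => [|j /negbTE ->]; last by rewrite mulr0n.
rewrite addr0 ds -mulr_sumr -mulrBr big_split /=.
have -> : \sum_j \sum_m dnewton k H (T j) j m * H m i = 0.
  rewrite exchange_big big1// => m _.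
  by rewrite -mulr_suml df mul0r.
rewrite add0r (_ : \tr _ = \sum_j \sum_m newton k H j m * T j m i) ?subrr ?mulr0//.
rewrite /mxtrace; apply: eq_bigr => j _; rewrite mxE.
by apply: eq_bigr => m _; rewrite T_sym.
Qed.

Let divfree0 i : \sum_j dnewton 0 H (T j) j i = 0.
Proof. by rewrite big1// => j _; rewrite mxE. Qed.

Lemma dnewton1_divfree i : \sum_j dnewton 1 H (T j) j i = 0.
Proof. by apply: divfreeS => // l; exact: dsigma1. Qed.

Lemma dnewton3_divfree i : \sum_j dnewton 3 H (T j) j i = 0.
Proof.
apply: divfreeS => [l|]; first exact: dsigma3.
apply: divfreeS => [l|]; first exact: dsigma2.
exact: dnewton1_divfree.
Qed.

End divergence_free.

End newton_divergence.

(** * Contractions of a curvature tensor of Gauss form *)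

Section contractions.
Context {R : realType} {n : nat}.

Lemma quad_sum (X Y : 'I_n -> 'I_n -> R) :
  \sum_a \sum_b \sum_c \sum_d X a c * Y b d =
  (\sum_a \sum_c X a c) * (\sum_b \sum_d Y b d).
Proof.
rewrite mulr_suml; apply: eq_bigr => a _.
rewrite mulr_sumr; apply: eq_bigr => b _.
rewrite mulr_suml; apply: eq_bigr => c _.
by rewrite mulr_sumr.
Qed.

Lemma quad_sum_cross (X Y : 'I_n -> 'I_n -> R) :
  \sum_a \sum_b \sum_c \sum_d X a d * Y b c =
  (\sum_a \sum_c X a c) * (\sum_b \sum_d Y b d).
Proof.
rewrite -quad_sum; apply: eq_bigr => a _; apply: eq_bigr => b _.
by rewrite exchange_big.
Qed.

Lemma congruence_sum (G M : 'M[R]_n) i j :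
  \sum_a \sum_b G i a * G j b * M a b = (G *m M *m G^T) i j.
Proof.
rewrite mxE exchange_big; apply: eq_bigr => b _.
rewrite mxE mulr_suml; apply: eq_bigr => a _.
by rewrite mxE; ring.
Qed.

Variables (g : 'rV[R]_n -> 'M[R]_n) (x : 'rV[R]_n) (c : R) (H : 'M[R]_n).
Let G := invmetric g x.
Hypothesis G_sym : G^T = G.
Hypothesis H_sym : H^T = H.
Hypothesis riemE : forall i j k l,
  riemann_curv g i j k l x = c * (H i k * H j l - H i l * H j k).

Let A := G *m H.
Let S := G *m H *m G.
Let Ric := c *: (\tr A *: H - H *m G *m H).

Let Gs i j : G i j = G j i.
Proof. by rewrite -[in LHS]G_sym mxE. Qed.

Let Ric_sym : Ric^T = Ric.
Proof. by rewrite /Ric linearZ linearB linearZ /= !trmx_mul G_sym H_sym mulmxA. Qed.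

Let S_sym : S^T = S.
Proof. by rewrite /S !trmx_mul G_sym H_sym mulmxA. Qed.

Let Ss i j : S i j = S j i.
Proof. by rewrite -[in LHS]S_sym mxE. Qed.

Let ricciE i k : ricci_curv g i k x = Ric i k.
Proof.
rewrite /ricci_curv -/G /Ric !mxE.
transitivity (\sum_j \sum_l (c * H i k * (G j l * H j l) -
    c * (H i l * G l j * H j k))).
  by apply: eq_bigr => j _; apply: eq_bigr => l _; rewrite riemE (Gs l j); ring.
under eq_bigr do rewrite sumrB; rewrite sumrB mulrBr; congr (_ - _).
  under eq_bigr do rewrite -mulr_sumr.
  by rewrite -mulr_sumr sum_entries_trace H_sym -/A; ring.
rewrite mulr_sumr; apply: eq_bigr => j _.
by rewrite mxE mulr_suml mulr_sumr.
Qed.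

Let ricci_raisedE i j : ricci_raised g i j x = (G *m Ric *m G) i j.
Proof.
rewrite -{2}G_sym -congruence_sum.
by apply: eq_bigr => a _; apply: eq_bigr => b _; rewrite ricciE.
Qed.

Let riemann_raisedE i j k l :
  riemann_raised g i j k l x = c * (S i k * S j l - S i l * S j k).
Proof.
have SE p q : S p q = \sum_a \sum_b G p a * G q b * H a b.
  by rewrite congruence_sum G_sym.
rewrite !SE -quad_sum -quad_sum_cross mulrBr !mulr_sumr -sumrB.
apply: eq_bigr => a _; rewrite !mulr_sumr -sumrB.
apply: eq_bigr => b _; rewrite !mulr_sumr -sumrB.
apply: eq_bigr => e _; rewrite !mulr_sumr -sumrB.
by apply: eq_bigr => d _; rewrite riemE -/G; ring.
Qed.

Let tau2 : \tr (H *m S) = \tr (A *m A).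
Proof. by rewrite /S /A mxtrace_mulC !mulmxA mxtrace_mulC !mulmxA. Qed.

Lemma scalar_curvE : scalar_curv g x = c * sigma 2 A.
Proof.
rewrite /scalar_curv -/G.
under eq_bigr do under eq_bigr do rewrite ricciE.
rewrite sum_entries_trace Ric_sym /Ric -scalemxAr mxtraceZ mulmxBr raddfB /=.
by rewrite -scalemxAr mxtraceZ sigma2 /A !mulmxA; ring.
Qed.

(** Of the four products in the square, two split into independent sums, each [\tr (A *m A)]; the
    two crossed ones close up into a cycle of length four. *)
Let riem_norm : \sum_i \sum_j \sum_k \sum_l
    riemann_curv g i j k l x * riemann_raised g i j k l x =
  c ^+ 2 * (2 * \tr (A *m A) ^+ 2 - 2 * \tr (A *m A *m A *m A)).
Proof.
have HS : \sum_i \sum_k H i k * S i k = \tr (A *m A).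
  by rewrite sum_entries_trace S_sym tau2.
have cross : \sum_i \sum_j \sum_k \sum_l H i k * S j k * (H j l * S i l) =
    \tr (A *m A *m A *m A).
  transitivity (\tr (H *m S *m (H *m S))); last first.
    by rewrite /S /A mxtrace_mulC !mulmxA mxtrace_mulC !mulmxA.
  rewrite /mxtrace; apply: eq_bigr => i _; rewrite mxE; apply: eq_bigr => j _.
  rewrite !mxE mulr_suml; apply: eq_bigr => k _; rewrite mulr_sumr.
  apply: eq_bigr => l _.
  by rewrite (Ss j k) (Ss i l).
have E : \sum_i \sum_j \sum_k \sum_l
    riemann_curv g i j k l x * riemann_raised g i j k l x =
  c ^+ 2 * (\sum_i \sum_j \sum_k \sum_l H i k * S i k * (H j l * S j l))
  + c ^+ 2 * (\sum_i \sum_j \sum_k \sum_l H i l * S i l * (H j k * S j k))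
  - c ^+ 2 * (\sum_i \sum_j \sum_k \sum_l H i k * S j k * (H j l * S i l))
  - c ^+ 2 * (\sum_i \sum_j \sum_k \sum_l H i l * S j l * (H j k * S i k)).
  rewrite !mulr_sumr -big_split -!sumrB; apply: eq_bigr => i _.
  rewrite !mulr_sumr -big_split -!sumrB; apply: eq_bigr => j _.
  rewrite !mulr_sumr -big_split -!sumrB; apply: eq_bigr => k _.
  rewrite !mulr_sumr -big_split -!sumrB; apply: eq_bigr => l _.
  by rewrite riemE riemann_raisedE /=; ring.
rewrite E (quad_sum (fun i k => H i k * S i k) (fun j l => H j l * S j l)).
rewrite (quad_sum_cross (fun i k => H i k * S i k) (fun j l => H j l * S j l)).
have -> : \sum_i \sum_j \sum_k \sum_l H i l * S j l * (H j k * S i k) =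
    \sum_i \sum_j \sum_k \sum_l H i k * S j k * (H j l * S i l).
  by apply: eq_bigr => i _; apply: eq_bigr => j _; rewrite exchange_big.
by rewrite cross HS; ring.
Qed.

Let ric_norm : \sum_i \sum_j ricci_curv g i j x * ricci_raised g i j x =
  c ^+ 2 * (\tr A ^+ 2 * \tr (A *m A) - 2 * \tr A * \tr (A *m A *m A)
            + \tr (A *m A *m A *m A)).
Proof.
under eq_bigr do under eq_bigr do rewrite ricciE ricci_raisedE.
rewrite sum_entries_trace !trmx_mul G_sym Ric_sym.
have -> : Ric *m (G *m (Ric *m G)) = (Ric *m G) *m (Ric *m G) by rewrite !mulmxA.
have -> : Ric *m G = c *: (\tr A *: (H *m G) - H *m G *m (H *m G)).
  by rewrite /Ric -scalemxAl mulmxBl -scalemxAl !mulmxA.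
set K := H *m G; set t := \tr A.
have c2 : \tr (K *m K) = \tr (A *m A).
  by rewrite /K /A !mulmxA mxtrace_mulC !mulmxA.
have c3 : \tr (K *m K *m K) = \tr (A *m A *m A).
  by rewrite /K /A !mulmxA mxtrace_mulC !mulmxA.
have c4 : \tr (K *m K *m K *m K) = \tr (A *m A *m A *m A).
  by rewrite /K /A !mulmxA mxtrace_mulC !mulmxA.
move: c2 c3 c4; move: (\tr (A *m A)) (\tr (A *m A *m A)) (\tr (A *m A *m A *m A)).
clearbody K t => a2 a3 a4 c2 c3 c4.
rewrite -scalemxAl -scalemxAr !mxtraceZ !(mulmxBl, mulmxBr) -!scalemxAl -!scalemxAr.
rewrite !(mxtraceD, mxtraceN, mxtraceZ) !mulmxA c2 c3 c4; ring.
Qed.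

(** The coefficients 1, -4, 1 are those that assemble the three contractions into Newton's identity
    [sigma4]. *)
Lemma gauss_bonnetE : gauss_bonnet g x = c ^+ 2 * sigma 4 A.
Proof.
by rewrite /gauss_bonnet riem_norm ric_norm scalar_curvE sigma4 sigma2; ring.
Qed.

End contractions.

(** * Curvature of a graph *)

Section matrix_fields.
Context {R : realType} {n : nat}.
Implicit Types (A B : 'rV[R]_n -> 'M[R]_n) (dA dB : 'I_n -> 'rV[R]_n -> 'M[R]_n).

Definition C1mx A dA : Prop :=
  forall i j, C1 (fun x => A x i j) (fun l x => dA l x i j).

Lemma C1mxM A dA B dB : C1mx A dA -> C1mx B dB ->
  C1mx (fun x => A x *m B x) (fun l x => dA l x *m B x + A x *m dB l x).
Proof.
move=> AC BC i j.
apply: C1_eq (C1_sum _ (fun k => C1M (AC i k) (BC k j))) _ _ => [x|l x].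
  by rewrite mxE.
by rewrite !mxE big_split addrC; congr (_ + _); apply: eq_bigr => k _; rewrite mulrC.
Qed.

Lemma C1_trace A dA : C1mx A dA ->
  C1 (fun x => \tr (A x)) (fun l x => \tr (dA l x)).
Proof. by move=> AC; exact: (C1_sum _ (fun k => AC k k)). Qed.

Lemma C1mx_newton k A dA : C1mx A dA ->
  C1mx (fun x => newton k (A x)) (fun l x => dnewton k (A x) (dA l x)).
Proof.
move=> AC; elim: k => [|k IH] i j /=.
  apply: C1_eq (C1_cst ((1%:M : 'M[R]_n) i j)) _ _ => // l x.
  by rewrite mxE.
have MC := C1mxM IH AC.
have CC := C1M (C1_cst (- k.+1%:R)) (MC i j).
have C' := C1M (C1_cst ((i == j)%:R)) (C1_trace MC).
apply: C1_eq (C1D C' CC) _ _ => [x|l x].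
  move: (newton k (A x) *m A x) => Q.
  by rewrite /cst !mxE mulNr !mulr_natl.
move: (newton k (A x) *m A x) (dnewton k (A x) (dA l x) *m A x + _) => Q Q'.
by rewrite /cst !mxE !mulr0 !addr0 mulNr !mulr_natl.
Qed.

End matrix_fields.

Lemma is_derive_inv {R : realType} (a : R) : a != 0 ->
  is_derive a 1 (fun z => z^-1) (- a^-1 ^+ 2).
Proof.
move=> a0; have := @is_deriveV R id a 1 1 a0 (is_derive_id a 1).
by rewrite /GRing.scale /= mulr1 exprVn.
Qed.

Lemma Ck_C1 {R : realType} {n : nat} k (u : 'rV[R]_n -> R) : Ck k.+1 u -> C1 u (fun i => partial i u).
Proof.
move=> [_ H] i; have [du Hk] := H i; split; first by case: k Hk {H} => [|k] [].
by move=> x; apply: DeriveDef => //; exact: du.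
Qed.

Section smooth_partials.
Context {R : realType} {n : nat}.
Variable f : 'rV[R]_n -> R.
Hypothesis f_smooth : smooth f.
Implicit Types (i j k : 'I_n).

Lemma smooth_C1 : C1 f (fun i => partial i f).
Proof. exact: Ck_C1 (f_smooth 1). Qed.

Lemma smooth_C1_partial i : C1 (partial i f) (fun j => partial j (partial i f)).
Proof.
have [_ /(_ i)[_ K]] := f_smooth 2; exact: (@Ck_C1 _ _ 0 (partial i f) K).
Qed.

Lemma smooth_C1_partial2 i j :
  C1 (partial j (partial i f)) (fun k => partial k (partial j (partial i f))).
Proof.
have [_ /(_ i)[_ [_ /(_ j)[_ K]]]] := f_smooth 3.
exact: (@Ck_C1 _ _ 0 (partial j (partial i f)) K).
Qed.

Lemma smooth_partial_comm i j : partial j (partial i f) = partial i (partial j f).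
Proof.
apply/funext => x; apply: partial_comm => [k y|k l y||].
- by have [_ /(_ y)[]] := smooth_C1 k.
- by have [_ /(_ y)[]] := smooth_C1_partial k l.
- by have [] := smooth_C1_partial i j.
- by have [] := smooth_C1_partial j i.
Qed.

Lemma smooth_partial2_comm i j k :
  partial k (partial j (partial i f)) = partial j (partial k (partial i f)).
Proof.
apply/funext => x; apply: partial_comm => [l y|l m y||].
- by have [_ /(_ y)[]] := smooth_C1_partial i l.
- by have [_ /(_ y)[]] := smooth_C1_partial2 i l m.
- by have [] := smooth_C1_partial2 i j k.
- by have [] := smooth_C1_partial2 i k j.
Qed.

End smooth_partials.

(** * Rates of decay at infinity *)

Section decay.
Context {R : realType} {n : nat}.
Implicit Types (u v : 'rV[R]_n -> R) (q : R).

(** Continuity is carried along because [sphere_flux_decay] asks for it together with the bound. *)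
Definition decays q u : Prop := continuous u /\ bigO_infty u (- q).

(** Raising the threshold to at least 1 makes powers of [enorm x] monotone in the exponent, which
    [decays_le] relies on. *)
Lemma decaysP q u : decays q u -> exists C M : R,
  [/\ 0 <= C, 1 <= M & forall x, M < enorm x -> `|u x| <= C * enorm x `^ (- q)].
Proof.
move=> [_ [C [M H]]]; exists `|C|, (Num.max 1 M); split=> //; first by rewrite le_max lexx.
move=> x; rewrite gt_max => /andP[_ Mx]; apply: le_trans (H x Mx) _.
by rewrite ler_wpM2r ?powR_ge0// ler_norm.
Qed.

Lemma decays_bounded u K : continuous u -> (forall x, `|u x| <= K) -> decays 0 u.
Proof.
move=> cu uK; split=> //; exists K, 0 => x _.
by rewrite oppr0 powRr0 mulr1.
Qed.

Lemma decays_cst (a : R) : decays 0 (fun=> a).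
Proof. by apply: (@decays_bounded _ `|a|) => //; exact: cst_continuous. Qed.

Lemma decaysD q u v : decays q u -> decays q v -> decays q (fun x => u x + v x).
Proof.
move=> du dv; have [C [M [C0 M1 uC]]] := decaysP du; have [D [N [D0 N1 vD]]] := decaysP dv.
split=> [x|]; first exact: (continuousD (proj1 du x) (proj1 dv x)).
exists (C + D), (Num.max M N) => x; rewrite gt_max => /andP[Mx Nx].
by rewrite (le_trans (ler_normD _ _))// mulrDl lerD// ?uC// vD.
Qed.

Lemma decaysM q r u v : decays q u -> decays r v -> decays (q + r) (fun x => u x * v x).
Proof.
move=> du dv; have [C [M [C0 M1 uC]]] := decaysP du; have [D [N [D0 N1 vD]]] := decaysP dv.
split=> [x|]; first exact: (continuousM (proj1 du x) (proj1 dv x)).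
exists (C * D), (Num.max M N) => x; rewrite gt_max => /andP[Mx Nx].
have x0 : 0 < enorm x by rewrite (lt_le_trans _ (ltW Mx))// (lt_le_trans ltr01).
rewrite normrM opprD powRD; last by apply/implyP => _; rewrite gt_eqF.
by rewrite mulrACA ler_pM// ?uC// vD.
Qed.

Lemma decays_le q r u : r <= q -> decays q u -> decays r u.
Proof.
move=> rq du; have [C [M [C0 M1 uC]]] := decaysP du.
split; first by case: du.
exists C, M => x Mx; apply: le_trans (uC x Mx) _.
by rewrite ler_wpM2l// ler_powR ?lerN2// (le_trans M1)// ltW.
Qed.

Lemma decaysZ q (a : R) u : decays q u -> decays q (fun x => a * u x).
Proof. by move=> du; have := decaysM (decays_cst a) du; rewrite add0r. Qed.

Lemma decaysB q u v : decays q u -> decays q v -> decays q (fun x => u x - v x).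
Proof.
move=> du dv; have := decaysD du (decaysZ (-1) dv).
by under [X in decays _ X -> _]eq_fun do rewrite mulN1r.
Qed.

Lemma decays_sum q (I : Type) (s : seq I) (F : I -> 'rV[R]_n -> R) :
  (forall k, decays q (F k)) -> decays q (fun x => \sum_(k <- s) F k x).
Proof.
move=> dF; elim: s => [|k s IH].
  under eq_fun do rewrite big_nil.
  split; first exact: cst_continuous.
  by exists 0, 0 => x _; rewrite normr0 mul0r.
under eq_fun do rewrite big_cons.
exact: decaysD.
Qed.

Lemma decays_eq q u v : u =1 v -> decays q u -> decays q v.
Proof. by move=> uv; have -> : u = v by apply/funext. Qed.

End decay.

(** The same bordered matrix is factored into block triangular matrices in two ways. *)
Lemma det_rank1_update {R : comPzRingType} {n : nat} (u : 'cV[R]_n) (v : 'rV[R]_n) :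
  \det (1%:M + u *m v) = 1 + (v *m u) 0 0.
Proof.
have E1 : block_mx 1%:M (- v) u 1%:M =
    block_mx 1%:M 0 u 1%:M *m block_mx 1%:M (- v) 0 (1%:M + u *m v).
  rewrite mulmx_block !(mul1mx, mulmx1, mul0mx, mulmx0) !addr0 mulmxN.
  by rewrite addrCA addNr addr0.
have E2 : block_mx 1%:M (- v) u 1%:M =
    block_mx (1%:M + v *m u) (- v) 0 1%:M *m block_mx 1%:M 0 u 1%:M.
  rewrite mulmx_block !(mul1mx, mulmx1, mul0mx, mulmx0) !add0r mulNmx.
  by rewrite addrK.
have := congr1 determinant E1; rewrite {1}E2 !det_mulmx !det_ublock !det_lblock.
by rewrite !det1 !mul1r !mulr1 => <-; rewrite det_mx11 !mxE eqxx.
Qed.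

(* [p], [h] and [t] stand for the first, second and third partial derivatives of the
   function whose graph is considered. *)
Section graph.
Context {R : realType} {n : nat}.
Variables (p : 'I_n -> 'rV[R]_n -> R) (h : 'I_n -> 'I_n -> 'rV[R]_n -> R)
  (t : 'I_n -> 'I_n -> 'I_n -> 'rV[R]_n -> R).
Hypothesis pC : forall i, C1 (p i) (h i).
Hypothesis hC : forall i j, C1 (h i j) (t i j).
Hypothesis h_sym : forall i j x, h i j x = h j i x.
Hypothesis t_sym : forall i j k x, t i j k x = t i k j x.
Hypothesis t_symC : forall i j k x, t i j k x = t j i k x.
Implicit Types (i j k l m : 'I_n) (x : 'rV[R]_n).

Let H x : 'M[R]_n := \matrix_(i, j) h i j x.
Let T l x : 'M[R]_n := \matrix_(i, j) t i j l x.

Let C1mx_H : C1mx H T.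
Proof.
by move=> i j; apply: (C1_eq (hC i j)) => [x|l x]; rewrite mxE.
Qed.

Let H_sym x : (H x)^T = H x.
Proof. by apply/matrixP => i j; rewrite !mxE. Qed.

Let W x : R := 1 + \sum_i p i x ^+ 2.
(** The vector [H p], half the gradient of [W]. *)
Let w i x := \sum_k p k x * h k i x.

Let slope_ge1 x : 1 <= W x.
Proof. by rewrite /W lerDl sumr_ge0// => i _; exact: sqr_ge0. Qed.

Let slope_neq0 x : W x != 0.
Proof. by rewrite gt_eqF// (lt_le_trans ltr01 (slope_ge1 x)). Qed.

Let C1_slope : C1 W (fun i x => 2 * w i x).
Proof.
apply: C1_eq (C1D (C1_cst 1) (C1_sum _ (fun k => C1M (pC k) (pC k)))) _ _ => [x|i x].
  by rewrite /W /cst; congr (_ + _).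
by rewrite /cst add0r big_split /= mulr_natl mulr2n.
Qed.

Let C1_slopeV : C1 (fun x => (W x)^-1) (fun i x => - (W x)^-1 ^+ 2 * (2 * w i x)).
Proof.
apply: (C1_comp1 (P := fun a => a^-1) (dP := fun a => - a^-1 ^+ 2) C1_slope) => x.
  exact: is_derive_inv (slope_neq0 x).
have -> : (fun a : R => - a^-1 ^+ 2) = (fun a => - (a^-1 * a^-1)).
  by apply/funext => a; rewrite expr2.
have V : {for W x, continuous (fun a : R => a^-1)} by apply: inv_continuous; exact: slope_neq0.
exact: (continuousN (continuousM V V)).
Qed.

Let g x : 'M[R]_n := \matrix_(i, j) ((i == j)%:R + p i x * p j x).
(** The Sherman-Morrison inverse of [g]. *)
Let G x : 'M[R]_n := \matrix_(i, j) ((i == j)%:R - p i x * p j x / W x).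

Let gE x i j : g x i j = (i == j)%:R + p i x * p j x.
Proof. by rewrite mxE. Qed.

Let GE x i j : G x i j = (i == j)%:R - p i x * p j x / W x.
Proof. by rewrite mxE. Qed.

Let dmetricE i j k x : dmetric g i j k x = h i k x * p j x + p i x * h j k x.
Proof.
have C := C1D (C1_cst (i == j)%:R) (C1M (pC i) (pC j)).
rewrite /dmetric (_ : (fun y => g y i j) = fun y => (i == j)%:R + p i y * p j y).
  by rewrite (C1_partial C) /cst add0r addrC; congr (_ + _); rewrite mulrC.
by apply/funext => y; rewrite gE.
Qed.

Let sum_p2 x : \sum_k p k x ^+ 2 = W x - 1.
Proof. by rewrite /W addrC addKr. Qed.

Let G_p m x : \sum_k G x m k * p k x = p m x / W x.
Proof.
have E k : G x m k * p k x = p k x * (m == k)%:R - p m x / W x * p k x ^+ 2.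
  by rewrite GE; ring.
under eq_bigr do rewrite E.
rewrite sumrB sum_delta -mulr_sumr sum_p2 mulrBr mulr1 divfK ?slope_neq0//.
by rewrite opprB addrC subrK.
Qed.

Let invmetricE x : invmetric g x = G x.
Proof.
have E : g x *m G x = 1%:M.
  apply/matrixP => i j; rewrite mxE.
  have E k : g x i k * G x k j = G x k j * (i == k)%:R + p i x * (G x j k * p k x).
    by rewrite gE !GE [k == j]eq_sym; ring.
  under eq_bigr do rewrite E.
  by rewrite big_split /= sum_delta -mulr_sumr G_p GE mxE; ring.
by have [_ V] := mulmx1_unit E; rewrite /invmetric -[RHS]mul1mx -(mulVmx (proj1 (mulmx1_unit E))) -mulmxA E mulmx1.
Qed.

(** The three derivatives of the metric collapse to [2 h_ij p_k], and raising the index of [p]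
    divides it by [W]. *)
Let christoffelE m i j x : christoffel g m i j x = h i j x * (p m x / W x).
Proof.
rewrite /christoffel invmetricE -G_p [in RHS]mulr_sumr mulr_sumr.
apply: eq_bigr => k _; rewrite !dmetricE.
by rewrite (h_sym j i) (h_sym k i) (h_sym k j); field.
Qed.

Let partial_christoffel m j k i x : partial i (christoffel g m j k) x =
  h m i x * h j k x / W x + p m x * t j k i x / W x
  - 2 * p m x * h j k x * w i x / W x ^+ 2.
Proof.
have -> : christoffel g m j k = fun y => h j k y * (p m y * (W y)^-1).
  by apply/funext => y; rewrite christoffelE.
rewrite (C1_partial (C1M (hC j k) (C1M (pC m) C1_slopeV))).
by field; exact: slope_neq0.
Qed.

Let riemann_upE i j k m x : riemann_up g i j k m x =
  (h m i x * h j k x - h m j x * h i k x) / W x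
  - p m x * (h j k x * w i x - h i k x * w j x) / W x ^+ 2.
Proof.
rewrite /riemann_up !partial_christoffel.
have -> : \sum_s (christoffel g m i s x * christoffel g s j k x -
    christoffel g m j s x * christoffel g s i k x) =
  p m x / W x ^+ 2 * (h j k x * w i x - h i k x * w j x).
  rewrite /w mulrBr !mulr_sumr -sumrB; apply: eq_bigr => s _.
  rewrite !christoffelE (h_sym s i) (h_sym s j).
  by field; exact: slope_neq0.
(* The third derivatives cancel by symmetry, which leaves an expression quadratic in the Hessian. *)
have -> : t j k i x = t i k j x.
  by rewrite t_sym t_symC.
by field; exact: slope_neq0.
Qed.

(** Gauss's equation, the second fundamental form being the Hessian over [Num.sqrt (W x)]. All terms
    in [w] cancel when the index is lowered. *)
Let riemann_curvE i j k l x : riemann_curv g i j k l x =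
  (W x)^-1 * (H x i k * H x j l - H x i l * H x j k).
Proof.
rewrite /riemann_curv !mxE.
have E m : g x k m * riemann_up g i j l m x =
    (p m x * h m i x) * (p k x * h j l x / W x)
    - (p m x * h m j x) * (p k x * h i l x / W x)
    - p m x ^+ 2 * (p k x * (h j l x * w i x - h i l x * w j x) / W x ^+ 2)
    + ((h m i x * h j l x - h m j x * h i l x) / W x
  - p m x * (h j l x * w i x - h i l x * w j x) / W x ^+ 2) * (k == m)%:R.
  by rewrite riemann_upE gE; ring.
under eq_bigr do rewrite E.
rewrite big_split /= sum_delta !sumrB -!mulr_suml sum_p2 -!/(w _ _).
rewrite (h_sym k i) (h_sym k j).
by field; exact: slope_neq0.
Qed.

Let u x : 'cV[R]_n := \col_i p i x.
Let v x : 'rV[R]_n := (W x)^-1 *: ((\row_i p i x) *m H x).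

Let uE x i (j : 'I_1) : u x i j = p i x.
Proof. by rewrite mxE. Qed.

Let vE x (i : 'I_1) j : v x i j = (W x)^-1 * w j x.
Proof. by rewrite mxE mxE; congr (_ * _); apply: eq_bigr => k _; rewrite !mxE. Qed.

Let HE x i j : H x i j = h i j x.
Proof. by rewrite mxE. Qed.

Let shape_updateE x : invmetric g x *m H x = H x - u x *m v x.
Proof.
rewrite invmetricE; apply/matrixP => i j.
have -> : (H x - u x *m v x) i j = h i j x - p i x * ((W x)^-1 * w j x).
  by rewrite mxE HE [X in _ + X]mxE; congr (_ - _); rewrite mxE big_ord1 uE vE.
rewrite mxE.
have E k : G x i k * H x k j = h k j x * (i == k)%:R - p i x / W x * (p k x * h k j x).
  by rewrite GE HE; ring.
under eq_bigr do rewrite E.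
by rewrite sumrB sum_delta -mulr_sumr mulrA.
Qed.

Let invmetric_sym x : (invmetric g x)^T = invmetric g x.
Proof.
rewrite invmetricE; apply/matrixP => i j; rewrite mxE !GE eq_sym.
by rewrite [p j x * _]mulrC.
Qed.

Let scalar_curvE' x : scalar_curv g x =
  (W x)^-1 * (sigma 2 (H x) - 2 * (v x *m newton 1 (H x) *m u x) 0 0).
Proof.
rewrite -sigma2_update -shape_updateE.
by apply: scalar_curvE => *; [exact: invmetric_sym|exact: H_sym|exact: riemann_curvE].
Qed.

Let gauss_bonnetE' x : gauss_bonnet g x =
  (W x)^-1 ^+ 2 * (sigma 4 (H x) - 4 * (v x *m newton 3 (H x) *m u x) 0 0).
Proof.
rewrite -sigma4_update -shape_updateE.
by apply: gauss_bonnetE => *; [exact: invmetric_sym|exact: H_sym|exact: riemann_curvE].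
Qed.

Let det_g x : \det (g x) = W x.
Proof.
have -> : g x = 1%:M + u x *m (u x)^T.
  by apply/matrixP => i j; rewrite gE !mxE big_ord1 !mxE.
rewrite det_rank1_update mxE; congr (1 + _); apply: eq_bigr => i _.
by rewrite !mxE expr2.
Qed.

Let volume_densityE x : volume_density g x = Num.sqrt (W x).
Proof. by rewrite /volume_density det_g. Qed.

(* The divergence of this field involves no derivative of the Newton tensor. *)
Let newton_field (d : nat) (c : 'rV[R]_n -> R) j x := c x * \sum_i newton d (H x) j i * p i x.

(** The weight [c] is to be [W^-e]. Since the Newton tensor is divergence free, only [p] and the
    weight are differentiated: the first gives [sigma d.+1 (H x)], the second the rank one
    correction. Matching the coefficients 2 and 4 of [sigma2_update] and [sigma4_update] forces [e]
    to be 1 and 2. *)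
Let C1_newton_field (d : nat) (e : R) (c : 'rV[R]_n -> R) :
  C1 c (fun l x => - (2 * e * (c x / W x * w l x))) ->
  (forall x i, \sum_j dnewton d (H x) (T j x) j i = 0) ->
  exists dV, (forall j, C1 (newton_field d c j) (dV j)) /\
    forall x, \sum_j dV j j x =
      c x * (sigma d.+1 (H x) - 2 * e * (v x *m newton d (H x) *m u x) 0 0).
Proof.
move=> cC divfree.
have NC := C1mx_newton d C1mx_H.
exists (fun j l x => c x * (\sum_i (newton d (H x) j i * h i l x +
      p i x * dnewton d (H x) (T l x) j i)) +
    (\sum_i newton d (H x) j i * p i x) * - (2 * e * (c x / W x * w l x))).
split=> [j|x].
  exact: (C1M cC (C1_sum _ (fun i => C1M (NC j i) (pC i)))).
rewrite big_split /= -mulr_sumr mulrBr; congr (_ + _).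
  congr (_ * _); under eq_bigr do rewrite big_split.
  rewrite big_split /= [X in _ + X]exchange_big /= [X in _ + X]big1 => [|i _].
    rewrite addr0 /sigma -[X in \tr (_ *m X)]H_sym -sum_entries_trace.
    by under [RHS]eq_bigr do under eq_bigr do rewrite HE h_sym.
  by rewrite -mulr_sumr divfree mulr0.
have -> : (v x *m newton d (H x) *m u x) 0 0 =
    (W x)^-1 * \sum_j w j x * \sum_i newton d (H x) j i * p i x.
  rewrite -mulmxA mxE mulr_sumr; apply: eq_bigr => j _; rewrite vE -mulrA.
  by congr (_ * (_ * _)); rewrite mxE; apply: eq_bigr => i _; rewrite uE.
rewrite mulr_sumr mulr_sumr mulr_sumr -sumrN; apply: eq_bigr => j _; ring.
Qed.

Let T_sym x i j m : T j x m i = T i x m j.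
Proof. by rewrite !mxE t_sym. Qed.

Let V1 := newton_field 1 (fun x => (W x)^-1).
Let V2 := newton_field 3 (fun x => (W x)^-1 * (W x)^-1).

Let div_V1 : exists dV, (forall j, C1 (V1 j) (dV j)) /\
  forall x, \sum_j dV j j x = scalar_curv g x.
Proof.
have [||dV [VC dVE]] := @C1_newton_field 1 1 (fun x => (W x)^-1).
- apply: (C1_eq C1_slopeV) => // l x; by field; exact: slope_neq0.
- by move=> x i; apply: dnewton1_divfree; exact: T_sym.
by exists dV; split=> // x; rewrite dVE scalar_curvE' mulr1.
Qed.

Let div_V2 : exists dV, (forall j, C1 (V2 j) (dV j)) /\
  forall x, \sum_j dV j j x = gauss_bonnet g x.
Proof.
have [||dV [VC dVE]] := @C1_newton_field 3 2 (fun x => (W x)^-1 * (W x)^-1).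
- apply: (C1_eq (C1M C1_slopeV C1_slopeV)) => // l x; by field; exact: slope_neq0.
- by move=> x i; apply: dnewton3_divfree; exact: T_sym.
by exists dV; split=> // x; rewrite dVE gauss_bonnetE' expr2 -natrM.
Qed.

Let adm j x := \sum_i (dmetric g i j i x - dmetric g i i j x).

(** [g_ij,i - g_ii,j] reduces to [h_ii p_j - h_ij p_i], whose sum over [i] is the Newton field
    before the weight [1/W]. *)
Let admE j x : adm j x = \sum_i newton 1 (H x) j i * p i x.
Proof.
rewrite /adm newton1.
have E i : ((\tr (H x))%:M - H x) j i * p i x =
    p i x * \tr (H x) * (j == i)%:R - h i j x * p i x.
  by move: (\tr _) => a; rewrite mxE mxE [X in _ + X]mxE HE h_sym -mulr_natr; ring.
under [RHS]eq_bigr do rewrite E.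
rewrite [RHS]sumrB sum_delta /mxtrace mulr_sumr -sumrB; apply: eq_bigr => i _.
by rewrite HE !dmetricE (h_sym j i); ring.
Qed.

Let adm_egbE i x : \sum_j (dmetric g i j j x - dmetric g j j i x) = adm i x.
Proof.
by apply: eq_bigr => j _; rewrite !dmetricE (h_sym i j); ring.
Qed.

(** The rate [tau / 2] of the first derivatives. *)
Variable s : R.
Hypothesis s_ge0 : 0 <= s.
Hypothesis p_decay : forall i, decays s (p i).
Hypothesis h_decay : forall i j, decays (s + 1) (h i j).

Let WV_decay : decays 0 (fun x => (W x)^-1).
Proof.
apply: (@decays_bounded _ _ _ 1) => [|x]; first exact: C1_continuous C1_slopeV.
have W1 := slope_ge1 x; have W0 := lt_le_trans ltr01 W1.
by rewrite ger0_norm ?invr_ge0 ?(ltW W0)// invf_le1.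
Qed.

Let invmetric_decay i j : decays 0 (fun x => invmetric g x i j).
Proof.
apply: (@decays_eq _ _ _ (fun x => (i == j)%:R - p i x * p j x * (W x)^-1)) => [x|].
  by rewrite invmetricE GE.
apply: decaysB; first exact: decays_cst.
apply: decays_le (decaysM (decaysM (p_decay i) (p_decay j)) WV_decay).
by rewrite addr0 addr_ge0.
Qed.

Let dmetric_decay i j k : decays (s + (s + 1)) (dmetric g i j k).
Proof.
apply: (decays_eq (fun x => esym (dmetricE i j k x))).
apply: decaysD (decaysM (p_decay i) (h_decay j k)).
by rewrite addrC; exact: decaysM.
Qed.

(** The rate of a product of two second derivatives, shared by all the curvature tensors. *)
Let q : R := (s + 1) + (s + 1).

Let decays0M r (a b : 'rV[R]_n -> R) : decays 0 a -> decays r b ->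
  decays r (fun x => a x * b x).
Proof. by move=> da db; have := decaysM da db; rewrite add0r. Qed.

Let decaysM0 r (a b : 'rV[R]_n -> R) : decays r a -> decays 0 b ->
  decays r (fun x => a x * b x).
Proof. by move=> da db; have := decaysM da db; rewrite addr0. Qed.

Let riemann_decay i j k l : decays q (riemann_curv g i j k l).
Proof.
apply: (@decays_eq _ _ _ (fun x => (W x)^-1 * (h i k x * h j l x - h i l x * h j k x))).
  by move=> x; rewrite riemann_curvE !HE.
by apply: decays0M => //; apply: decaysB; exact: decaysM.
Qed.

Let ricci_decay i j : decays q (ricci_curv g i j).
Proof.
rewrite /ricci_curv; apply: decays_sum => a; apply: decays_sum => b.
exact: decays0M.
Qed.

Let scalar_decay : decays q (scalar_curv g).
Proof.
rewrite /scalar_curv; apply: decays_sum => a; apply: decays_sum => b.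
exact: decays0M.
Qed.

Let riemann_raised_decay i j k l : decays q (riemann_raised g i j k l).
Proof.
rewrite /riemann_raised; do 4! [apply: decays_sum => ?].
by apply: decays0M => //; do 3! [apply: decays0M => //].
Qed.

Let ricci_raised_decay i j : decays q (ricci_raised g i j).
Proof.
rewrite /ricci_raised; do 2! [apply: decays_sum => ?].
by apply: decays0M => //; apply: decays0M.
Qed.

Let P_decay i j k l : decays q (P_tensor g i j k l).
Proof.
have RG a b c d : decays q (fun x => ricci_raised g a b x * invmetric g x c d).
  exact: decaysM0.
apply: decaysD; last first.
  apply: decaysM0; first exact: decaysZ.
  by apply: decaysB; exact: decays0M.
apply: decaysD; last exact: RG.
apply: decaysB; last exact: RG.
apply: decaysB; last exact: RG.
by apply: decaysD; last exact: RG.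
Qed.

Let newton_decay (d : nat) i j : decays (d%:R * (s + 1)) (fun x => newton d (H x) i j).
Proof.
elim: d i j => [|d IH] i j /=.
  by rewrite mul0r; exact: decays_cst.
have M a b : decays (d.+1%:R * (s + 1)) (fun x => (newton d (H x) *m H x) a b).
  apply: (@decays_eq _ _ _ (fun x => \sum_c newton d (H x) a c * h c b x)).
    by move=> x; rewrite mxE; apply: eq_bigr => c _; rewrite HE.
  by apply: decays_sum => c; rewrite -natr1 mulrDl mul1r; exact: decaysM.
apply: (@decays_eq _ _ _ (fun x => (i == j)%:R * \tr (newton d (H x) *m H x)
    - d.+1%:R * (newton d (H x) *m H x) i j)).
  by move=> x; move: (_ *m H x) => Q; rewrite !mxE mulr_natl.
by apply: decaysB; apply: decaysZ => //; exact: decays_sum.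
Qed.

Let adm_decay j : decays ((s + 1) + s) (adm j).
Proof.
apply: (decays_eq (fun x => esym (admE j x))); apply: decays_sum => i.
by apply: decaysM => //; have := newton_decay 1 j i; rewrite mul1r.
Qed.

Let V2_decay j : decays (3 * (s + 1) + s) (V2 j).
Proof.
apply: decays0M; first exact: decays0M.
by apply: decays_sum => i; apply: decaysM => //; exact: newton_decay.
Qed.

(* The ADM integrand is [W] times [V1], hence the gain of two factors [p]. *)
Let admB_decay j : decays ((s + 1) + s + (s + s)) (fun x => adm j x - V1 j x).
Proof.
apply: (@decays_eq _ _ _ (fun x => adm j x * ((\sum_i p i x * p i x) * (W x)^-1))).
  move=> x; rewrite /V1 /newton_field -admE.
  have -> : \sum_i p i x * p i x = W x - 1.
    by rewrite -sum_p2; apply: eq_bigr => i _; rewrite expr2.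
  by field; exact: slope_neq0.
apply: decaysM => //; apply: decaysM0 => //.
by apply: decays_sum => i; exact: decaysM.
Qed.

Let egb_decay i :
  decays (q + (s + (s + 1)))
    (fun x => \sum_j \sum_k \sum_l P_tensor g i j k l x * dmetric g j k l x).
Proof. by do 3! [apply: decays_sum => ?]; exact: decaysM. Qed.

Hypothesis n_gt0 : (0 < n)%N.
Hypothesis s_gt : (n%:R - 2) / 2 < 2 * s.
Variable alpha : R.
Let L x : R := scalar_curv g x + alpha * gauss_bonnet g x.
Hypothesis L_integrable : g_integrable g L.

Local Notation mu := (@lebesgue_Rn R n).

Lemma graph_fluxes : [/\
  adm_flux g r @[r --> +oo] --> \int[mu]_x L x,
  egb_flux g alpha r @[r --> +oo] --> \int[mu]_x L x &
  g_integral g (fun x => L x / Num.sqrt (W x)) = \int[mu]_x L x].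
Proof.
have [dV1 [C1V1 dV1E]] := div_V1; have [dV2 [C1V2 dV2E]] := div_V2.
(* Only the combination of the two curvatures is assumed integrable, so the divergence theorem is
   applied to the combined field; [V2] is removed afterwards through its decay. *)
pose V j x := V1 j x + alpha * V2 j x.
pose dV j l x := dV1 j l x + alpha * dV2 j l x.
have VC j : C1 (V j) (dV j).
  apply: (C1_eq (C1D (C1V1 j) (C1M (C1_cst alpha) (C1V2 j)))) => // l x.
  by rewrite /cst mulr0 addr0.
have divV x : \sum_j dV j j x = L x.
  by rewrite big_split /= dV1E -mulr_sumr dV2E.
have cL : continuous L.
  have -> : L = fun x => \sum_j dV j j x by apply/funext => x; rewrite divV.
  by apply: continuous_bigsum => j _; have [] := VC j j.
have sqrtW1 x : 1 <= Num.sqrt (W x).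
  by rewrite -[leLHS]sqrtr1 ler_sqrt// (le_trans ler01 (slope_ge1 x)).
have iL : mu.-integrable setT (EFin \o (fun x => \sum_j dV j j x)).
  have -> : (fun x => \sum_j dV j j x) = L by apply/funext.
  (* The volume density [Num.sqrt (W x)] is at least 1, so integrability for [dV_g] implies
     integrability for Lebesgue measure. *)
  apply: le_integrable L_integrable => //.
    by apply/measurable_EFinP; exact: continuous_measurable_rV.
  move=> x _; rewrite /= lee_fin volume_densityE normrM ler_peMr//.
  by rewrite ger0_norm ?sqrtr_ge0.
have perturb (E : 'I_n -> 'rV[R]_n -> R) r : n%:R - 1 < r ->
    (forall j, decays r (E j)) ->
    sphere_flux (fun j x => V j x + E j x) r @[r --> +oo] --> \int[mu]_x L x.
  move=> nr Er; have cV j : continuous (V j) by exact: C1_continuous (VC j).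
  rewrite -[X in _ --> X]addr0.
  have -> : \int[mu]_x L x = \int[mu]_x (\sum_j dV j j x).
    by congr (Rintegral _ _ _); apply/funext => x; rewrite divV.
  apply: (cvg_trans _ (cvgD (divergence_theorem_infty n_gt0 VC iL)
    (sphere_flux_decay n_gt0 (fun j => proj1 (Er j)) (fun j => proj2 (Er j)) nr))).
  apply: near_eq_cvg; near=> a; have a0 : 0 < a by near: a; exact: nbhs_pinfty_gt.
  by rewrite sphere_fluxD// => j; exact: (proj1 (Er j)).
(* This is [4 s + 1], the rate of the slowest error [adm - V1]; [V2] and the term in [P_tensor] have
   rate [4 s + 3]. The hypothesis [s_gt] says exactly that [n%:R - 1 < r]. *)
pose r := (s + 1) + s + (s + s).
have nr : n%:R - 1 < r by rewrite /r; move: s_gt; lra.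
have V2r j : decays r (V2 j) by apply: decays_le (V2_decay j); rewrite /r; lra.
split.
- apply: cvg_trans (perturb (fun j x => (adm j x - V1 j x) - alpha * V2 j x) r nr _); last first.
    by move=> j; apply: decaysB => //; exact: decaysZ.
  apply: near_eq_cvg; near=> a; rewrite /adm_flux; congr (sphere_flux _ a).
  by apply/funext => j; apply/funext => x; rewrite -/(adm j x) /V; ring.
- pose E2 i x := \sum_j \sum_k \sum_l P_tensor g i j k l x * dmetric g j k l x.
  apply: cvg_trans (perturb (fun j x => (adm j x - V1 j x) - alpha * V2 j x
      + 2 * alpha * E2 j x) r nr _); last first.
    move=> j; apply: decaysD; first by apply: decaysB => //; exact: decaysZ.
    by apply: decaysZ; apply: decays_le (egb_decay j); rewrite /r /q; lra.
  apply: near_eq_cvg; near=> a; rewrite /egb_flux; congr (sphere_flux _ a).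
  by apply/funext => j; apply/funext => x; rewrite adm_egbE /V /E2; ring.
- rewrite /g_integral; congr (Rintegral _ _ _); apply/funext => x.
  by rewrite volume_densityE divfK// gt_eqF// (lt_le_trans ltr01).
Unshelve. all: by end_near.
Qed.

End graph.

(** * The masses of an asymptotically flat graph *)

Lemma asymptotically_flat_partial2 {R : realType} {n : nat} (tau : R)
    (f : 'rV[R]_n -> R) i j : asymptotically_flat tau f ->
  bigO_infty (partial j (partial i f)) (- (tau / 2 + 1)).
Proof.
move=> [_ /(_ i j i)[C [M CM]]]; exists C, (Num.max 0 M) => x.
rewrite gt_max => /andP[x0 Mx].
rewrite opprD powRD; last by apply/implyP => _; rewrite gt_eqF.
rewrite powR_inv1 ?(ltW x0)// mulrA.
rewrite ler_pdivlMr// -mulNr mulrC.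
apply: le_trans (CM x Mx); apply: le_trans (ler_norm _).
by rewrite lerDl mulr_ge0 ?exprn_ge0// ltW.
Qed.

Theorem theorem7p2 (R : realType) (n : nat) (hn : (4 <= n)%N)
    (f : 'rV[R]_n -> R) (tau : R) (alpha : R)
    (htau : (n%:R - 2) / 2 < tau)
    (f_smooth : smooth f) (f_flat : asymptotically_flat tau f)
    (L_integrable : g_integrable (graph_metric f) (fun x =>
       scalar_curv (graph_metric f) x + alpha * gauss_bonnet (graph_metric f) x)) :
  let g := graph_metric f in
  let L := fun x => scalar_curv g x + alpha * gauss_bonnet g x in
  [/\ cvg (adm_flux g r @[r --> +oo]),
      cvg (egb_flux g alpha r @[r --> +oo]),
      m_ADM g = m_EGB g alpha,
      m_EGB g alpha = (2 * (n%:R - 1) * @sphere_area R n)^-1 *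
        g_integral g (fun x => L x / Num.sqrt (1 + enorm (grad f x) ^+ 2)) &
      (forall x, 0 <= L x) -> 0 <= m_ADM g].
Proof.
move=> g L.
have n4 : (4 : R) <= n%:R by rewrite ler_nat.
have tau0 : 0 < tau by move: htau; lra.
have pD i : decays (tau / 2) (partial i f).
  split; first by have [] := smooth_C1 f_smooth i.
  by rewrite -mulNr; exact: (proj1 f_flat).
have hD i j : decays (tau / 2 + 1) (partial j (partial i f)).
  split; first by have [] := smooth_C1_partial f_smooth i j.
  exact: asymptotically_flat_partial2.
have [admE egbE gE] : [/\
    adm_flux g r @[r --> +oo] --> \int[lebesgue_Rn n]_x L x,
    egb_flux g alpha r @[r --> +oo] --> \int[lebesgue_Rn n]_x L x &
    g_integral g (fun x => L x / Num.sqrt (1 + \sum_i partial i f x ^+ 2)) =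
      \int[lebesgue_Rn n]_x L x].
  apply: (graph_fluxes (smooth_C1_partial f_smooth) (smooth_C1_partial2 f_smooth)
    _ _ _ _ pD hD _ _ L_integrable).
  - by move=> i j x; rewrite smooth_partial_comm.
  - by move=> i j k x; rewrite smooth_partial2_comm.
  - by move=> i j k x; rewrite (smooth_partial_comm f_smooth i j).
  - by rewrite divr_ge0// ltW.
  - by rewrite (leq_trans _ hn).
  - by move: htau; lra.
have gradE x : \sum_i partial i f x ^+ 2 = enorm (grad f x) ^+ 2.
  rewrite sqr_sqrtr; last by apply: sumr_ge0 => i _; exact: sqr_ge0.
  by apply: eq_bigr => i _; rewrite mxE.
have mADM : m_ADM g = @mass_constant R n * \int[lebesgue_Rn n]_x L x.
  by rewrite /m_ADM (cvg_lim _ admE).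
have mEGB : m_EGB g alpha = @mass_constant R n * \int[lebesgue_Rn n]_x L x.
  by rewrite /m_EGB (cvg_lim _ egbE).
split.
- by apply/cvg_ex; exists (\int[lebesgue_Rn n]_x L x).
- by apply/cvg_ex; exists (\int[lebesgue_Rn n]_x L x).
- by rewrite mADM mEGB.
- rewrite mEGB -gE; congr (_ * g_integral _ _); apply/funext => x.
  by rewrite gradE.
- move=> L0; rewrite mADM mulr_ge0//; last by apply: Rintegral_ge0.
  (* Only the sign of the constant matters here, and [sphere_area] is nonnegative as the [fine] part
     of a measure. *)
  rewrite /mass_constant invr_ge0 mulr_ge0//; first by move: n4; lra.
  exact: fine_ge0.
Qed.
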